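(* Let $(R,\mathfrak m_R,\kappa)$ be a complete normal Noetherian local domain of characteristic $p>0$ with algebraically closed residue field, let $z\in\mathfrak m_R\setminus\mathfrak m_R^2$, and let $J\subset R$ be an $\mathfrak m_R$-primary ideal. For any real numbers $t_1,t_2\ge 0$ and any $\alpha\in[0,1]$, $$\varphi_J\big(R;\,z^{\alpha t_1+(1-\alpha)t_2}\big)\ \ge\ \alpha\,\varphi_J\big(R;\,z^{t_1}\big)+(1-\alpha)\,\varphi_J\big(R;\,z^{t_2}\big).$$ That is, $t\mapsto\varphi_J(R;z^t)$ is concave on $[0,\infty)$.
   Context: For a Noetherian local ring $(A,\mathfrak m_A)$ of characteristic $p>0$ and dimension $d$ and an $\mathfrak m_A$-primary ideal $I$, $e_{\mathrm{HK}}(A,I)=\lim_{e\to\infty}\frac{1}{p^{ed}}\lambda_A\big(A/I^{[p^e]}\big)$, where $I^{[p^e]}=(x^{p^e}\mid x\in I)$ and $\lambda_A$ is length. For $n\ge1$, $R_n=R[Y]/(Y^n-z)=R[z^{1/n}]$, where $z^{1/n}$ is the class of $Y$ (an $n$th root of $z$ in $R^+$, the integral closure of $R$ in an algebraic closure of its fraction field); $R_n$ is a local domain. Write $z^{a/b}=(z^{1/b})^a$. For integers $a,b>0$ define $\varphi_J(R;z^{a/b})=\frac1b\,e_{\mathrm{HK}}\big(R_b,(J,z^{a/b})R_b\big)$, which depends only on the rational number $a/b$, and $\varphi_J(R;z^0)=0$. For real $t\ge0$ define $\varphi_J(R;z^t)=\lim_{k\to\infty}\varphi_J(R;z^{r_k})$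 for any sequence of positive rationals $r_k\to t$ (the limit exists and is independent of the sequence). *)

(* Defs.v *)
From HB Require Import structures.
From mathcomp Require Import all_boot all_order all_algebra.
From mathcomp Require Import qpoly fraction mxpoly.
From mathcomp Require Import all_classical all_reals all_analysis.

Set Implicit Arguments.
Unset Strict Implicit.
Unset Printing Implicit Defensive.

Import Order.TTheory GRing.Theory Num.Theory.
Import numFieldNormedType.Exports.

Local Open Scope classical_set_scope.
Local Open Scope ring_scope.

(* Ideals are [set A]s, and the unit ideal is one of them, unlike with
   [idealr_closed] of ring_quotient, which requires [1 \notin S]. *)
Definition is_ideal (A : comNzRingType) (I : set A) : Prop :=
  I 0 /\ forall a x y, I x -> I y -> I (a * x + y).

Definition ideal_gen (A : comNzRingType) (S : set A) : set A :=
  smallest (@is_ideal A) S.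

Fixpoint ideal_pow (A : comNzRingType) (I : set A) (n : nat) : set A :=
  if n is n'.+1 then ideal_gen [set x * y | x in I & y in ideal_pow I n']
  else setT.

Definition frobenius_power (A : comNzRingType) (I : set A) (q : nat) : set A :=
  ideal_gen [set x ^+ q | x in I].

Definition is_prime_ideal (A : comNzRingType) (P : set A) : Prop :=
  [/\ is_ideal P, ~ P 1 & forall x y, P (x * y) -> P x \/ P y].

Definition is_maximal_ideal (A : comNzRingType) (m : set A) : Prop :=
  [/\ is_ideal m, ~ m 1 & forall I, is_ideal I -> m `<=` I -> ~ I 1 -> I = m].

Definition radical (A : comNzRingType) (I : set A) : set A :=
  [set x | exists n, I (x ^+ n)].

Definition is_primary_ideal (A : comNzRingType) (Q : set A) : Prop :=
  [/\ is_ideal Q, ~ Q 1 & forall x y, Q (x * y) -> Q x \/ radical Q y].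

Definition primary_to (A : comNzRingType) (m Q : set A) : Prop :=
  is_primary_ideal Q /\ radical Q = m.

Definition noetherian (A : comNzRingType) : Prop :=
  forall I : set A, is_ideal I -> exists s : seq A, I = ideal_gen [set` s].

Definition is_local (A : comNzRingType) (m : set A) : Prop :=
  is_maximal_ideal m /\ forall n : set A, is_maximal_ideal n -> n = m.

Definition residue_map (A : comNzRingType) (m : set A) (kappa : fieldType)
    (pi : {rmorphism A -> kappa}) : Prop :=
  (forall y, exists x, pi x = y) /\ pi @^-1` [set 0] = m.

(* The canonical map from A to the inverse limit of the A / m ^ n is bijective:
   [x] is a family of representatives of a compatible system of classes.
   Uniqueness of [y] is m-adic separatedness. *)
Definition complete_for (A : comNzRingType) (m : set A) : Prop :=
  forall x : nat -> A, (forall n, ideal_pow m n (x n.+1 - x n)) ->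
    exists! y, forall n, ideal_pow m n (y - x n).

Definition normal_domain (A : idomainType) : Prop :=
  forall u : {fraction A},
    integralOver (@tofrac A) u -> exists a : A, u = tofrac a.

(* [supremum 0%N] is the least upper bound of a nonempty bounded set of
   naturals, and 0 otherwise. Both suprema below are finite for the rings and
   ideals of interest: A Noetherian local, I primary to the maximal ideal. *)
Definition krull_dim (A : comNzRingType) : nat :=
  supremum 0%N [set n : nat | exists P : nat -> set A,
    (forall i, (i <= n)%N -> is_prime_ideal (P i)) /\
    (forall i, (i < n)%N -> P i `<` P i.+1)].

(* The length of the A-module A / I: its submodules are the N / I, for N an
   ideal of A containing I. *)
Definition quotient_length (A : comNzRingType) (I : set A) : nat :=
  supremum 0%N [set n : nat | exists N : nat -> set A,
    (forall i, (i <= n)%N -> is_ideal (N i) /\ I `<=` N i) /\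
    (forall i, (i < n)%N -> N i `<` N i.+1)].

Definition eHK (K : realType) (p : nat) (A : comNzRingType) (I : set A) : K :=
  lim (((quotient_length (frobenius_power I (p ^ e)))%:R
         / (p ^ (e * krull_dim A))%:R : K) @[e --> \oo]).

(* R_n = R[Y] / (Y ^ n - z) is [{poly %/ root_poly z n}] for n > 0; [qpolyC] is
   the structure map from R, and ['qX] is the class of Y, i.e. z ^ (1/n). *)
Definition root_poly (R : comNzRingType) (z : R) (n : nat) : {poly R} :=
  'X^n - z%:P.

Definition root_ideal (R : comNzRingType) (J : set R) (z : R) (a b : nat) :
    set {poly %/ root_poly z b} :=
  ideal_gen (qpolyC (root_poly z b) @` J `|` [set 'qX ^+ a]).
Arguments root_ideal {R} J z a b.

Definition phi_frac (K : realType) (p : nat) (R : comNzRingType)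
    (J : set R) (z : R) (a b : nat) : K :=
  b%:R^-1 * eHK K p (root_ideal J z a b).

Definition phi_rat (K : realType) (p : nat) (R : comNzRingType)
    (J : set R) (z : R) (r : rat) : K :=
  if r == 0 then 0 else phi_frac K p J z `|numq r|%N `|denq r|%N.

(* The common limit along all the sequences of positive rationals that tend
   to t; meaningful for t >= 0. *)
Definition phi (K : realType) (p : nat) (R : comNzRingType)
    (J : set R) (z : R) (t : K) : K :=
  xget 0 [set v : K | forall r : nat -> rat,
    (forall k, 0 < r k) ->
    (ratr (r k) : K) @[k --> \oo] --> t ->
    phi_rat K p J z (r k) @[k --> \oo] --> v].

(* Main.v *)
Require Import Defs.
From HB Require Import structures.
From mathcomp Require Import all_boot all_order all_algebra.
From mathcomp Require Import qpoly zify ring lra.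
From mathcomp Require Import all_classical all_reals all_analysis.

Set Implicit Arguments.
Unset Strict Implicit.
Unset Printing Implicit Defensive.

Import Order.TTheory GRing.Theory Num.Theory.
Import numFieldNormedType.Exports.

Local Open Scope classical_set_scope.
Local Open Scope ring_scope.

(** The ring R_b is free over R with basis the powers of Y below Y ^ b. If q is
    a power of p and a q = b c + rho with rho < b, then Y ^ (a q) is
    z ^ c Y ^ rho, so the q-th Frobenius power of (J, Y ^ a) is the direct sum
    of b - rho copies of J^[q] + (z ^ c) and rho copies of
    J^[q] + (z ^ (c + 1)) ([frobenius_root]). With
    L_q n := length (R / (J^[q] + (z ^ n))), the length of the quotient is b
    times the value at q a / b of the piecewise linear interpolation of L_q
    ([quotient_length_root], [limit_frac]).

    The sequence L_q is concave: multiplication by z maps each layer of the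
    z-adic filtration of R / J^[q] onto the next one
    ([root_length_concave]). Therefore f_q t := L_q (q t) / q ^ d is a concave
    function of t, where d is the dimension of R, and so is a pointwise limit
    of these functions. It remains to see that they converge, to a continuous
    function; as R_b, an integral extension of R, has dimension d too
    ([krull_dim_integral]), this limit is then phi at every positive rational,
    hence at every real t >= 0.

    A length in R modulo the q-th Frobenius powers of J grows at most like q to
    the power of the dimension ([length_growth]). Hence f_q is bounded, and as
    the slopes of L_q are at most L_q 1 = O(q ^ (d - 1)), it is Lipschitz
    uniformly in q. For the convergence, R is a finite module over its p-th
    powers because it is complete with a perfect residue field
    ([frobenius_finite]). If r is its rank, then R^r and R, seen as a module
    over its p-th powers, are isomorphic up to torsion, and torsion only
    contributes O(q ^ (d - 1)) ([frobenius_length]). So f_(pq) and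
    (r / p ^ d) f_q differ by O(1 / q) ([root_length_frobenius]). Whether
    r / p ^ d is at most or at least one, the bounded sequence of the f_q t is
    then monotone up to a summable error, and it converges ([f_cvg]).

    The dimension of R is defined by chains of primes, and all this needs it to
    be finite. For primes P < P', the Artin-Rees lemma bounds the
    Hilbert-Samuel function of P' by differences of that of P, which lowers the
    degree of growth by one, and the degree for P = 0 is at most the number of
    generators of m ([prime_chain_growth], [krull_dim_max]). *)

(** * Submodules and their lengths *)

Section Submodules.
Variables (A : comNzRingType) (V : lmodType A).
Implicit Types (N M L : set V) (x y : V) (a : A).

Definition submod (N : set V) : Prop :=
  N 0 /\ forall a x y, N x -> N y -> N (a *: x + y).

Definition adjoin (N : set V) (x : V) : set V := [set y | exists a, N (y - a *: x)].

Lemma submodZ N a x : submod N -> N x -> N (a *: x).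
Proof. by move=> [N0 Nl] Nx; rewrite -[_ *: _]addr0; apply: Nl. Qed.

Lemma submodD N x y : submod N -> N x -> N y -> N (x + y).
Proof. by move=> [N0 Nl] Nx Ny; rewrite -[x]scale1r; apply: Nl. Qed.

Lemma submodN N x : submod N -> N x -> N (- x).
Proof. by move=> sN Nx; rewrite -scaleN1r; apply: submodZ. Qed.

Lemma submodB N x y : submod N -> N x -> N y -> N (x - y).
Proof. by move=> sN Nx Ny; apply: submodD => //; apply: submodN. Qed.

Lemma submodBr N x y : submod N -> N (x - y) -> N y -> N x.
Proof. by move=> sN Nx Ny; rewrite -[x](subrK y); apply: submodD. Qed.

Lemma submod_sum N I (r : seq I) (P : pred I) (F : I -> V) :
  submod N -> (forall i, P i -> N (F i)) -> N (\sum_(i <- r | P i) F i).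
Proof. by move=> sN NF; apply: big_ind => //; [case: sN|move=> *; apply: submodD]. Qed.

Lemma submodT : submod [set: V]. Proof. by split. Qed.

Lemma submodI N M : submod N -> submod M -> submod (N `&` M).
Proof. by move=> [N0 Nl] [M0 Ml]; split=> // a x y [? ?] [? ?]; split; auto. Qed.

Lemma submod_adjoin N x : submod N -> submod (adjoin N x).
Proof.
move=> [N0 Nl]; split; first by exists 0; rewrite scale0r subr0.
move=> a y y' [b Ny] [b' Ny']; exists (a * b + b').
have -> : a *: y + y' - (a * b + b') *: x = a *: (y - b *: x) + (y' - b' *: x).
  by rewrite scalerBr scalerDl scalerA opprD addrACA.
exact: Nl.
Qed.

Lemma sub_adjoin N x : N `<=` adjoin N x.
Proof. by move=> y Ny; exists 0; rewrite scale0r subr0. Qed.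

Lemma mem_adjoin N x : submod N -> adjoin N x x.
Proof. by move=> [N0 _]; exists 1; rewrite scale1r subrr. Qed.

Lemma adjoin_sub N M x : submod M -> N `<=` M -> M x -> adjoin N x `<=` M.
Proof.
by move=> sM NM Mx y [a Ny]; apply: (submodBr sM (NM _ Ny)); apply: submodZ.
Qed.

Lemma adjoinS N M x : N `<=` M -> adjoin N x `<=` adjoin M x.
Proof. by move=> NM y [a Ny]; exists a; apply: NM. Qed.

Definition schain (N M : set V) (n : nat) : Prop :=
  exists c : nat -> set V,
    (forall i, (i <= n)%N -> [/\ submod (c i), N `<=` c i & c i `<=` M]) /\
    (forall i, (i < n)%N -> c i `<` c i.+1).

(** The supremum of the lengths of the strict chains, as for [quotient_length];
    it is 0 when these lengths are unbounded. *)
Definition len (N M : set V) : nat := supremum 0%N [set n | schain N M n].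

Lemma schain_rcons N M M' n : submod M' -> N `<=` M' -> M `<` M' ->
  schain N M n -> schain N M' n.+1.
Proof.
move=> sM' NM' MM' [c [c1 c2]].
exists (fun i => if (i <= n)%N then c i else M'); split=> i.
  case: (leqP i n) => [/c1[? ? cM] _|_ _]; split=> //.
  by apply: subset_trans cM _; case: MM'.
rewrite ltnS => le_in; rewrite le_in; case: ltnP => [/c2//|le_ni].
have -> : i = n by apply/eqP; rewrite eqn_leq le_in.
have [_ _ cM] := c1 n (leqnn n).
by case: MM' => MM' nM; split=> [y /cM /MM' //|s]; apply: nM => y /s /cM.
Qed.

Lemma schain0 N M : submod M -> N `<=` M -> schain N M 0.
Proof. by move=> sM NM; exists (fun=> M); split=> [i _|i] //; split. Qed.

Lemma schain_cat N M L n k : N `<=` M -> M `<=` L ->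
  schain N M n -> schain M L k -> schain N L (n + k).
Proof.
move=> NM ML [c [c1 c2]] [c' [c1' c2']].
exists (fun i => if (i < n)%N then c i else c' (i - n)%N); split=> i.
  case: ltnP => [/ltnW/c1[? ? ?] _|le_ni].
    by split=> //; apply: subset_trans ML.
  rewrite -leq_subLR => /c1'[? Mc ?]; split=> //; exact: subset_trans Mc.
case: (ltnP i.+1 n) => [lt_in _|le_ni lt_ink].
  by rewrite (ltnW lt_in); apply: c2; apply: ltnW.
case: ltnP => [lt_in|le_ni'].
  have -> : (i.+1 - n = 0)%N by lia.
  have [_ Mc _] := c1' 0%N isT.
  have e : n = i.+1 by lia.
  have [cc cc'] := c2 _ lt_in; have [_ _ cM] := c1 n (leqnn n).
  have {}Mc : c i.+1 `<=` c' 0%N by rewrite -e; apply: subset_trans Mc.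
  by split=> [y /cc /Mc //|s]; apply: cc' => y /Mc /s.
by rewrite subSn //; apply: c2'; lia.
Qed.

End Submodules.

Section SimpleSteps.
Variables (A : comNzRingType) (m : set A).
Hypothesis m_field : forall a, ~ m a -> exists b, m (b * a - 1).
Variable V : lmodType A.
Implicit Types (N M L : set V) (x y : V) (a : A).

(** A filtration of M / N by k cyclic layers that are killed by m. A layer may be
    zero, so k is an upper bound of the length: such filtrations are easy to
    build and have images under all kinds of maps, and the inequalities between
    lengths are proved by means of them. *)
Inductive lle N : set V -> nat -> Prop :=
| lle0 : lle N N 0
| lleS M k x : lle N M k -> (forall a, m a -> M (a *: x)) ->
    lle N (adjoin M x) k.+1.

Lemma lle_submod N M k : submod N -> lle N M k -> submod M.
Proof. by move=> sN; elim=> // {}M {}k x _ sM _; apply: submod_adjoin. Qed.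

Lemma lle_sub N M k : lle N M k -> N `<=` M.
Proof.
elim=> // {}M {}k x _ NM _; apply: subset_trans NM _; exact: sub_adjoin.
Qed.

Lemma lle_trans N M L k k' : lle N M k -> lle M L k' -> lle N L (k + k').
Proof.
move=> NM; elim=> [|{}L {}k' x _ NL Lx]; first by rewrite addn0.
by rewrite addnS; apply: lleS.
Qed.

Lemma lle_mono N M k k' : submod N -> (k <= k')%N -> lle N M k -> lle N M k'.
Proof.
move=> sN /subnK <-; elim: (k' - k)%N => // j IH /IH {IH}; rewrite addSn.
move=> NM; have sM := lle_submod sN NM.
have -> : M = adjoin M 0.
  apply/seteqP; split; first exact: sub_adjoin.
  by move=> y [a]; rewrite scaler0 subr0.
by apply: lleS NM _ => a _; rewrite scaler0; case: sM.
Qed.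

(** The number of layers that a submodule meets is a strictly monotone rank: if
    L < L' have the same intersection with the part M below a layer, then L'
    meets this layer and L does not: L + M would otherwise contain L', and L'
    would be L + (L' `&` M) = L. *)
Lemma lle_rank N M k : submod N -> lle N M k ->
  exists d : set V -> nat, (forall L, (d L <= k)%N) /\
    forall L L', submod L -> submod L' -> N `<=` L -> L `<` L' -> L' `<=` M ->
      (d L < d L')%N.
Proof.
move=> sN; elim=> [|{}M {}k x NM [d [dk dS]] Mx].
  by exists (fun=> 0%N); split=> // L L' _ _ NL [_ nL] L'N; case: nL => y /L'N/NL.
have sM := lle_submod sN NM; have NsM := lle_sub NM.
exists (fun L => d (L `&` M) + (~~ `[< L `<=` M >]))%N; split=> [L|L L' sL sL' NL [LL' nL] L'M].
  by rewrite (leq_trans (leq_add (dk _) (leq_b1 _))) // addn1.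
have LM_L'M : (~~ `[< L `<=` M >] <= ~~ `[< L' `<=` M >])%N.
  case: asboolP => //= nLM; case: asboolP => // L'sM.
  by case: nLM; apply: subset_trans L'sM.
have [eqLM|neLM] := pselect (L' `&` M `<=` L `&` M); last first.
  rewrite -addSn leq_add //; apply: dS.
  - exact: submodI.
  - exact: submodI.
  - by move=> y Ny; split; [apply: NL|apply: NsM].
  - by split=> // y [/LL' ? ?].
  - by move=> y [].
have -> : L `&` M = L' `&` M.
  by apply/seteqP; split=> // y [/LL' ? ?].
rewrite ltn_add2l.
have nL'M : ~ (L' `<=` M).
  by move=> L'sM; apply: nL => y L'y; case: (eqLM y (conj L'y (L'sM y L'y))).
suff LsM : L `<=` M by rewrite (asboolT LsM) (asboolF nL'M).
apply: contrapT => /existsNP[l /not_implyP[Ll nMl]]; apply: nL => y L'y.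
suff [l' Ll' Mly] : exists2 l', L l' & M (y - l').
  apply: (submodBr sL _ Ll'); apply: (proj1 (eqLM (y - l') _)); split=> //.
  by apply: submodB => //; apply: LL'.
have [a Ma] := L'M _ (LL' _ Ll); have [b Mb] := L'M _ L'y.
have /m_field[c mc] : ~ m a.
  by move=> /Mx Max; apply: nMl; apply: (submodBr sM Ma Max).
(* As c inverts a modulo m, this multiple of l agrees with b *: x modulo M. *)
exists ((b * c) *: l); first exact: submodZ.
have -> : y - (b * c) *: l =
   (y - b *: x) - ((b * c) *: (l - a *: x) + b *: ((c * a - 1) *: x)).
  have -> : b *: ((c * a - 1) *: x) = (b * c * a) *: x - b *: x.
    by rewrite scalerA mulrBr mulr1 scalerBl mulrA.
  by rewrite scalerBr scalerA addrA subrK opprB addrA subrK.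
apply: submodB => //; apply: submodD => //; apply: submodZ => //; exact: Mx.
Qed.

Lemma lle_schain N M k n : submod N -> lle N M k -> schain N M n -> (n <= k)%N.
Proof.
move=> sN NM [c [c1 c2]]; have [d [dk dS]] := lle_rank sN NM.
suff dn i : (i <= n)%N -> (i <= d (c i))%N by apply: leq_trans (dk (c n)); apply: dn.
elim: i => // i IH lt_in; apply: leq_ltn_trans (IH (ltnW lt_in)) _.
have [? ? ?] := c1 i (ltnW lt_in); have [? ? ?] := c1 _ lt_in.
by apply: dS => //; apply: c2.
Qed.

(** The layers that are zero are dropped. *)
Lemma lle_strict N M k : submod N -> lle N M k ->
  exists k', [/\ (k' <= k)%N, lle N M k' & schain N M k'].
Proof.
move=> sN; elim=> [|{}M {}k x NM [k' [le_k' NM' cNM]] Mx].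
  by exists 0%N; split=> //; [exact: lle0|exact: schain0].
have sM := lle_submod sN NM.
have [xM|nxM] := pselect (M x).
  have -> : adjoin M x = M.
    by apply/seteqP; split; [exact: adjoin_sub|exact: sub_adjoin].
  by exists k'; split=> //; apply: leqW.
exists k'.+1; split=> //; first exact: lleS.
apply: schain_rcons cNM; first exact: submod_adjoin.
  by apply: subset_trans (lle_sub NM) _; apply: sub_adjoin.
by split=> [|/(_ _ (mem_adjoin x sM))//]; apply: sub_adjoin.
Qed.

Lemma supremum_nat (S : set nat) n :
  S n -> (forall k, S k -> (k <= n)%N) -> supremum 0%N S = n.
Proof.
move=> Sn Sle; have supSn : supremums S n by split=> [k /Sle|k /(_ _ Sn)]; rewrite leEnat.
rewrite /supremum; case: ifPn => [/eqP S0|_]; first by move: Sn; rewrite S0.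
by case: xgetP => [x _ supSx|/(_ _ supSn)//]; apply: is_subset1_supremums supSx supSn.
Qed.

Lemma lle_len_spec N M k : submod N -> lle N M k ->
  [/\ (len N M <= k)%N, lle N M (len N M) & schain N M (len N M)].
Proof.
move=> sN NM; have [k' [le_k' NM' cNM]] := lle_strict sN NM.
have -> // : len N M = k'.
by apply: supremum_nat => // j /(lle_schain sN NM').
Qed.

Lemma len_le N M k : submod N -> lle N M k -> (len N M <= k)%N.
Proof. by move=> sN /(lle_len_spec sN)[]. Qed.

Lemma lle_len N M k : submod N -> lle N M k -> lle N M (len N M).
Proof. by move=> sN /(lle_len_spec sN)[]. Qed.

Lemma schain_len N M k n : submod N -> lle N M k -> schain N M n -> (n <= len N M)%N.
Proof. by move=> sN /(lle_len_spec sN)[_ NM _]; apply: lle_schain. Qed.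

Lemma lenD N M L k k' : submod N -> lle N M k -> lle M L k' ->
  (len N L = len N M + len M L)%N.
Proof.
move=> sN NM ML; have sM := lle_submod sN NM.
have [_ NM' cNM] := lle_len_spec sN NM; have [_ ML' cML] := lle_len_spec sM ML.
have NL := lle_trans NM' ML'.
apply/eqP; rewrite eqn_leq (len_le sN NL) (schain_len sN NL) //.
exact: schain_cat (lle_sub NM) (lle_sub ML) cNM cML.
Qed.

End SimpleSteps.

Arguments lle {A} m {V}.

Definition imgmod (V W : zmodType) (f : V -> W) (N' : set W) (M : set V) : set W :=
  [set w | exists2 v, M v & N' (w - f v)].

(** One statement for linear maps and for maps that change the ring of scalars.
    A scalar of B must act on the image of f, modulo N', like a scalar of A,
    which is in m if the former is in m'; conversely, a scalar of A must act
    like one of B, up to a scalar in m, which acts as zero on a layer. *)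
Lemma lle_image (A B : comNzRingType) (m : set A) (m' : set B)
    (V : lmodType A) (W : lmodType B) (f : V -> W)
    (fB : {morph f : x y / x - y})
    (N M : set V) (N' : set W) k :
  submod N -> submod N' -> (forall v, N v -> N' (f v)) ->
  (forall b v, exists a, N' (b *: f v - f (a *: v))) ->
  (forall b v, m' b -> exists2 a, m a & N' (b *: f v - f (a *: v))) ->
  (forall a v, exists b a', m a' /\ N' (f (a *: v) - b *: f v - f (a' *: v))) ->
  lle m N M k -> lle m' N' (imgmod f N' M) k.
Proof.
move=> sN sN' fN H1 H2 H3.
have f0 : f 0 = 0 by rewrite -(subrr 0) fB subrr.
have fD : {morph f : x y / x + y}.
  by move=> x y; rewrite -{1}[y]opprK -[- y]sub0r !fB f0 sub0r opprK.
elim=> [|{}M {}k x NM IH Mx].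
  suff -> : imgmod f N' N = N' by exact: lle0.
  apply/seteqP; split=> [w [v /fN fv N'w]|w N'w]; first exact: submodBr N'w fv.
  by exists 0; [case: sN|rewrite f0 subr0].
have sM := lle_submod sN NM.
have -> : imgmod f N' (adjoin M x) = adjoin (imgmod f N' M) (f x).
  apply/seteqP; split=> [w [v [a Mv] N'w]|w [b [v Mv N'w]]].
    have [b [a' [ma' N'ba]]] := H3 a x.
    exists b, (v - a *: x + a' *: x); first by apply: submodD => //; apply: Mx.
    have -> : w - b *: f x - f (v - a *: x + a' *: x) =
       (w - f v) + (f (a *: x) - b *: f x - f (a' *: x)).
      rewrite fD fB !opprD opprK.
      rewrite -!addrA; congr (_ + _).
      by rewrite [- (b *: _) + _]addrC -!addrA; congr (_ + _); congr (_ + _); rewrite addrC.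
    exact: submodD.
  have [a N'ba] := H1 b x.
  exists (v + a *: x); first by exists a; rewrite addrK.
  have -> : w - f (v + a *: x) = (w - b *: f x - f v) + (b *: f x - f (a *: x)).
    by rewrite fD opprD addrA [w - b *: f x - f v]addrAC [RHS]addrA subrK.
  exact: submodD.
apply: lleS IH _ => b mb; have [a ma N'ba] := H2 b x mb.
by exists (a *: x) => //; apply: Mx.
Qed.

Lemma lle_linear (A : comNzRingType) (m : set A) (V W : lmodType A) (f : V -> W)
    (N M : set V) (N' M' : set W) k :
  m 0 -> (forall a, {morph f : x y / a *: x + y}) ->
  submod N -> submod N' -> (forall v, N v -> N' (f v)) ->
  (forall w, M' w <-> exists2 v, M v & N' (w - f v)) ->
  lle m N M k -> lle m N' M' k.
Proof.
move=> m0 fl sN sN' fN defM' NM.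
have N'0 : N' 0 by case: sN'.
have fB : {morph f : x y / x - y} by move=> x y; rewrite addrC -scaleN1r fl scaleN1r addrC.
have f0 : f 0 = 0 by rewrite -(subrr 0) fB subrr.
have fZ a v : f (a *: v) = a *: f v by rewrite -[a *: v]addr0 fl f0 addr0.
have -> : M' = imgmod f N' M by apply/seteqP; split=> w /defM'.
apply: (@lle_image A A m m V W f fB N M N' k sN sN' fN) NM.
- by move=> b v; exists b; rewrite fZ subrr.
- by move=> b v mb; exists b; rewrite ?fZ ?subrr.
- by move=> a v; exists a, 0; split=> //; rewrite fZ scale0r f0 !subrr.
Qed.

(** * Ideals, and Noetherian local rings *)

Section Ideals.
Variable A : comNzRingType.
Implicit Types (I J : set A) (x y a : A).

Lemma ideal0 I : is_ideal I -> I 0. Proof. by case. Qed.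

Lemma idealM I a x : is_ideal I -> I x -> I (a * x).
Proof. exact: (@submodZ A A^o). Qed.

Lemma idealD I x y : is_ideal I -> I x -> I y -> I (x + y).
Proof. exact: (@submodD A A^o). Qed.

Lemma idealB I x y : is_ideal I -> I x -> I y -> I (x - y).
Proof. exact: (@submodB A A^o). Qed.

Lemma idealBr I x y : is_ideal I -> I (x - y) -> I y -> I x.
Proof. exact: (@submodBr A A^o). Qed.

Lemma ideal_sum I T (r : seq T) (P : pred T) (F : T -> A) :
  is_ideal I -> (forall i, P i -> I (F i)) -> I (\sum_(i <- r | P i) F i).
Proof. exact: (@submod_sum A A^o). Qed.

Lemma idealT : is_ideal [set: A]. Proof. by split. Qed.

Lemma ideal1T I : is_ideal I -> I 1 -> I = setT.
Proof.
by move=> iI I1; apply/seteqP; split=> // x _; rewrite -[x]mulr1; apply: idealM.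
Qed.

Lemma ideal_gen_ideal (S : set A) : is_ideal (ideal_gen S).
Proof.
split=> [I [[]]//|a x y Sx Sy I [iI SI]].
by apply: idealD => //; [apply: idealM => //; apply: Sx|apply: Sy].
Qed.

Lemma sub_ideal_gen (S : set A) : S `<=` ideal_gen S.
Proof. exact: sub_gen_smallest. Qed.

Lemma mem_ideal_gen (s : seq A) x : x \in s -> ideal_gen [set` s] x.
Proof. by move=> sx; apply: (@sub_ideal_gen [set` s]). Qed.

Lemma ideal_gen_sub (S I : set A) : is_ideal I -> S `<=` I -> ideal_gen S `<=` I.
Proof. exact: smallest_sub. Qed.

Definition idealadd I x : set A := adjoin (I : set A^o) x.

Lemma idealadd_ideal I x : is_ideal I -> is_ideal (idealadd I x).
Proof. exact: (@submod_adjoin A A^o). Qed.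

Lemma sub_idealadd I x : I `<=` idealadd I x.
Proof. exact: (@sub_adjoin A A^o). Qed.

Lemma mem_idealadd I x : is_ideal I -> idealadd I x x.
Proof. exact: (@mem_adjoin A A^o). Qed.

Lemma idealadd_sub I J x : is_ideal J -> I `<=` J -> J x -> idealadd I x `<=` J.
Proof. exact: (@adjoin_sub A A^o). Qed.

Definition idealsum I J : set A := [set x | exists2 y, I y & J (x - y)].

Lemma idealsum_ideal I J : is_ideal I -> is_ideal J -> is_ideal (idealsum I J).
Proof.
move=> iI iJ; split; first by exists 0; [exact: ideal0|rewrite subr0; apply: ideal0].
move=> a x y [u Iu Jxu] [v Iv Jyv].
exists (a * u + v); first by apply: idealD => //; apply: idealM.
have -> : a * x + y - (a * u + v) = a * (x - u) + (y - v) by ring.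
by apply: idealD => //; apply: idealM.
Qed.

Lemma sub_idealsuml I J : is_ideal J -> I `<=` idealsum I J.
Proof. by move=> iJ x Ix; exists x => //; rewrite subrr; apply: ideal0. Qed.

Lemma sub_idealsumr I J : is_ideal I -> J `<=` idealsum I J.
Proof. by move=> iI x Jx; exists 0; rewrite ?subr0 //; apply: ideal0. Qed.

Lemma idealsum_sub I J L : is_ideal L -> I `<=` L -> J `<=` L -> idealsum I J `<=` L.
Proof. by move=> iL IL JL x [y /IL Ly /JL Lxy]; apply: idealBr Lxy Ly. Qed.

Lemma idealsumS I I' J J' : I `<=` I' -> J `<=` J' -> idealsum I J `<=` idealsum I' J'.
Proof. by move=> II' JJ' x [y /II' I'y /JJ' J'xy]; exists y. Qed.

Lemma ideal_pow_ideal I n : is_ideal (ideal_pow I n).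
Proof. by case: n => [|n]; [exact: idealT|exact: ideal_gen_ideal]. Qed.

Lemma ideal_powS I n x y : I x -> ideal_pow I n y -> ideal_pow I n.+1 (x * y).
Proof. by move=> Ix Iy; apply: sub_ideal_gen; exists x => //; exists y. Qed.

Lemma ideal_pow1 I : is_ideal I -> ideal_pow I 1 = I.
Proof.
move=> iI; apply/seteqP; split=> [|x Ix]; last first.
  by rewrite -[x]mulr1; apply: ideal_powS.
by apply: ideal_gen_sub => // _ [x Ix [y _ <-]]; rewrite mulrC; apply: idealM.
Qed.

Lemma ideal_pow_leq I i j : (i <= j)%N -> ideal_pow I j `<=` ideal_pow I i.
Proof.
move=> /subnK <-; elim: (j - i)%N => // k IH; rewrite addSn.
apply: ideal_gen_sub; first exact: ideal_pow_ideal.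
by move=> _ [x Ix [y /IH Iy <-]]; apply: idealM => //; apply: ideal_pow_ideal.
Qed.

Lemma noetherian_ind (P : set A -> Prop) : noetherian A ->
  (forall I, is_ideal I ->
    (forall J, is_ideal J -> I `<` J -> P J) -> P I) ->
  forall I, is_ideal I -> P I.
Proof.
move=> noethA step I iI; apply: contrapT => nPI.
pose T := {J : set A | is_ideal J /\ ~ P J}.
have next (J : T) : {J' : T | sval J `<` sval J'}.
  apply: cid; case: J => J [iJ nPJ] /=; apply: contrapT => noJ.
  apply/nPJ/step => // J' iJ' JJ'; apply: contrapT => nPJ'.
  by apply: noJ; exists (exist _ J' (conj iJ' nPJ')).
pose c := fix c n : T := if n is n'.+1 then sval (next (c n')) else exist _ I (conj iI nPI).
have cS n : sval (c n) `<` sval (c n.+1) by apply: (svalP (next (c n))).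
have ic n : is_ideal (sval (c n)) by case: (c n) => ? [].
have cM i j : (i <= j)%N -> sval (c i) `<=` sval (c j).
  move=> /subnK <-; elim: (j - i)%N => // k IH; rewrite addSn.
  by apply: subset_trans IH _; case: (cS (k + i)%N).
pose U := [set x | exists n, sval (c n) x].
have iU : is_ideal U.
  split; first by exists 0%N; apply: ideal0.
  move=> a x y [i cx] [j cy]; exists (maxn i j); apply: idealD => //.
    by apply: idealM => //; apply: cM cx; apply: leq_maxl.
  by apply: cM cy; apply: leq_maxr.
have [s Us] := noethA _ iU.
have [n cn] : exists n, forall x, x \in s -> sval (c n) x.
  have : forall x, x \in s -> U x by move=> x sx; rewrite Us; apply: sub_ideal_gen.
  elim: s {Us} => [|x s IH] sU; first by exists 0%N.
  have [|n cn] := IH; first by move=> y sy; apply: sU; rewrite inE sy orbT.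
  have [k ck] := sU x (mem_head _ _); exists (maxn n k) => y.
  rewrite inE => /predU1P[->|/cn cy]; first by apply: cM ck; apply: leq_maxr.
  by apply: cM cy; apply: leq_maxl.
case: (cS n) => _; apply=> x cx; have : U x by exists n.+1.
by rewrite Us; apply: ideal_gen_sub.
Qed.

End Ideals.

Section QuotientLength.
Variables (A : comNzRingType) (m : set A).
Hypothesis m_ideal : is_ideal m.
Implicit Types (I J N : set A) (x y a : A).

Local Notation ilen I k := (lle m (I : set A^o) [set: A^o] k).

Lemma quotient_lengthE I : quotient_length I = len (I : set A^o) [set: A^o].
Proof.
rewrite /quotient_length /len; congr supremum.
apply/seteqP; split=> n [c [c1 c2]]; exists c; split=> // i /c1.
  by case=> ? ?; split.
by case.
Qed.

Lemma ilen0 I : I 1 -> is_ideal I -> ilen I 0.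
Proof. by move=> I1 iI; rewrite (ideal1T iI I1); apply: lle0. Qed.

Lemma ilen_mono I k k' : is_ideal I -> (k <= k')%N -> ilen I k -> ilen I k'.
Proof. by move=> iI; apply: lle_mono. Qed.

Lemma ilenS I J k : is_ideal I -> is_ideal J -> I `<=` J -> ilen I k -> ilen J k.
Proof.
move=> iI iJ IJ; apply: (@lle_linear _ _ A^o A^o id) => //; first exact: ideal0 m_ideal.
move=> w; split=> // _; exists w => //; rewrite subrr; exact: ideal0.
Qed.

Lemma ilen_residue I : is_ideal I -> m `<=` I -> ilen I 1.
Proof.
move=> iI mI; have -> : [set: A^o] = adjoin (I : set A^o) 1.
  apply/seteqP; split=> // x _; exists x.
  by rewrite -[x *: _]/(x * 1) mulr1 subrr; apply: ideal0.
apply: lleS; first exact: lle0.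
by move=> a ma; rewrite -[a *: _]/(a * 1) mulr1; apply: mI.
Qed.

Lemma lle_idealadd I J x k : is_ideal I -> is_ideal J ->
  (forall y, J y -> I (y * x)) -> ilen J k -> lle m (I : set A^o) (idealadd I x) k.
Proof.
move=> iI iJ JI; apply: (@lle_linear _ _ A^o A^o (fun y => y * x)) => //.
- exact: ideal0 m_ideal.
- by move=> a u v; rewrite mulrDl -[a *: u]/(a * u) -mulrA.
- by move=> w; split=> [[a Iw]|[v _ Iw]]; [exists a|exists v].
Qed.

(** The exact sequence from A / (I : x) to A / I to A / (I + (x)). *)
Lemma ilen_split I J x k k' : is_ideal I -> is_ideal J ->
  (forall y, J y -> I (y * x)) ->
  ilen (idealadd I x) k -> ilen J k' -> ilen I (k + k').
Proof.
by move=> iI iJ JI Ix /(lle_idealadd iI iJ JI) II; rewrite addnC; apply: lle_trans Ix.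
Qed.

Definition colon I x : set A := [set y | I (y * x)].

Lemma colon_ideal I x : is_ideal I -> is_ideal (colon I x).
Proof.
move=> iI; split; rewrite /colon /mkset; first by rewrite mul0r; apply: ideal0.
by move=> a u v Iu Iv; rewrite mulrDl -mulrA; apply: idealD => //; apply: idealM.
Qed.

Lemma sub_colon I x : is_ideal I -> I `<=` colon I x.
Proof. by move=> iI y Iy; rewrite /colon /mkset mulrC; apply: idealM. Qed.

(** The layers of the x-adic filtration are quotients of A / (I + (x)). *)
Lemma ilen_pow I x n k : is_ideal I -> I (x ^+ n) ->
  ilen (idealadd I x) k -> ilen I (n * k).
Proof.
elim: n I => [|n IH] I iI Ixn Ix.
  by apply: ilen0 => //; rewrite -(expr0 x).
have iC := colon_ideal x iI.
rewrite mulSn; apply: (ilen_split iI iC _ Ix) => //.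
apply: IH => //; first by rewrite /colon /mkset -exprSr.
apply: ilenS Ix; try exact: idealadd_ideal.
exact: (@adjoinS A A^o _ _ _ (sub_colon x iI)).
Qed.

End QuotientLength.

Notation ilen m I k := (lle m (I : set _^o) setT k).

Section LocalRing.
Variables (A : comNzRingType) (m : set A).
Hypotheses (A_noeth : noetherian A) (A_local : is_local m).
Implicit Types (I J N : set A) (x y a : A).

Lemma local_ideal : is_ideal m. Proof. by case: A_local => [[]]. Qed.

Lemma local_proper : ~ m 1. Proof. by case: A_local => [[]]. Qed.

(** By Noetherian induction, every proper ideal lies in a maximal one. *)
Lemma sub_local I : is_ideal I -> ~ I 1 -> I `<=` m.
Proof.
move: I; apply: noetherian_ind => // I iI IH nI1.
have [maxI|] := pselect (is_maximal_ideal I).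
  by case: A_local => _ /(_ _ maxI) ->.
apply: contra_notP => nIm; split=> // J iJ IJ nJ1; apply/seteqP; split=> //.
apply: contrapT => nJI; apply: nIm; apply: (subset_trans IJ).
by apply: IH.
Qed.

Lemma local_unit a : ~ m a -> exists b, b * a = 1.
Proof.
move=> nma; apply: contrapT => noinv.
have iA := idealadd_ideal a (@ideal_gen_ideal A set0).
apply: nma; apply: (sub_local iA); last exact: (mem_idealadd _ (ideal_gen_ideal _)).
move=> [b g1]; apply: noinv; exists b; apply/eqP; rewrite eq_sym -subr_eq0; apply/eqP.
have : ideal_gen [set (0 : A)] `<=` [set 0].
  apply: ideal_gen_sub => //; split=> // c _ _ -> ->.
  by rewrite /mkset mulr0 addr0.
by apply; apply: ideal_gen_sub g1; [exact: ideal_gen_ideal|].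
Qed.

Lemma local_field a : ~ m a -> exists b, m (b * a - 1).
Proof.
by move=> /local_unit[b ba]; exists b; rewrite ba subrr; apply: ideal0 local_ideal.
Qed.

Lemma local_prime : is_prime_ideal m.
Proof.
split; [exact: local_ideal|exact: local_proper|move=> x y mxy].
apply: contrapT => /not_orP[/local_unit[b bx] /local_unit[c cy]].
apply: local_proper; have -> : 1 = (b * c) * (x * y).
  by rewrite mulrACA bx cy mulr1.
exact: idealM local_ideal mxy.
Qed.

Definition prime_chain I n : Prop := exists P : nat -> set A,
  [/\ forall i, (i <= n)%N -> is_prime_ideal (P i), I `<=` P 0%N &
      forall i, (i < n)%N -> P i `<` P i.+1].

Lemma prime_chain_cons P I n : is_prime_ideal P -> P `<` I ->
  prime_chain I n -> prime_chain P n.+1.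
Proof.
move=> primeP [PI nIP] [c [cp Ic cS]].
exists (fun i => if i is i'.+1 then c i' else P); split=> //.
  by case=> [|i] //; apply: cp.
case=> [_|i]; last exact: cS.
by split=> [x /PI /Ic //|s]; apply: nIP => x /Ic /s.
Qed.

Lemma prime_chainS I J n : I `<=` J -> prime_chain J n -> prime_chain I n.
Proof. by move=> IJ [c [cp Jc cS]]; exists c; split=> // x /IJ /Jc. Qed.

Lemma not_prime_ideal I : is_ideal I -> ~ I 1 -> ~ is_prime_ideal I ->
  exists a b, [/\ ~ I a, ~ I b & I (a * b)].
Proof.
move=> iI nI1; apply: contra_notP => noab; split=> // a b Iab.
by apply: contrapT => /not_orP[nIa nIb]; apply: noab; exists a, b.
Qed.

Lemma proper_idealadd I x : is_ideal I -> ~ I x -> I `<` idealadd I x.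
Proof.
move=> iI nIx; split; first exact: sub_idealadd.
by move/(_ _ (mem_idealadd x iI)).
Qed.

Definition bounded_growth J k I : Prop :=
  exists C, forall q, ilen m (idealsum I (frobenius_power J q)) (C * q ^ k)%N.

(** A nonprime I is split by two elements whose product it contains, so that
    by Noetherian induction it is enough to look at primes. *)
Lemma growth_primes J k I : is_ideal J -> is_ideal I ->
  (forall P, is_prime_ideal P -> I `<=` P -> bounded_growth J k P) ->
  bounded_growth J k I.
Proof.
have im := local_ideal; move=> iJ; move: I.
have iF q : is_ideal (frobenius_power J q) := ideal_gen_ideal _.
apply: noetherian_ind => // I iI IH primes.
have iS L q : is_ideal L -> is_ideal (idealsum L (frobenius_power J q)).
  by move=> iL; apply: idealsum_ideal.
have [I1|nI1] := pselect (I 1).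
  by exists 0%N => q; apply: ilen0; [exact: sub_idealsuml I1|exact: iS].
have [primeI|/(not_prime_ideal iI nI1)[a [b [nIa nIb Iab]]]] :=
  pselect (is_prime_ideal I); first exact: primes.
have grow x : ~ I x -> bounded_growth J k (idealadd I x).
  move=> nIx; apply: IH; [exact: idealadd_ideal|exact: proper_idealadd|].
  by move=> P pP IP; apply: primes => // y /(sub_idealadd x)/IP.
have [[C Ca] [D Db]] := (grow _ nIa, grow _ nIb).
have ia : is_ideal (idealadd I a) by exact: idealadd_ideal.
have ib : is_ideal (idealadd I b) by exact: idealadd_ideal.
exists (C + D)%N => q; rewrite mulnDl.
apply: (@ilen_split _ _ im _ (idealsum (idealadd I b) (frobenius_power J q)) a).
- exact: iS.
- exact: iS.
- apply: idealsum_sub; first exact/colon_ideal/iS.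
    apply: idealadd_sub; first exact/colon_ideal/iS.
      move=> y Iy; apply: (sub_colon _ (iS _ q iI)); exact: sub_idealsuml.
    by rewrite /mkset mulrC; apply: sub_idealsuml.
  by move=> y Jy; apply: (sub_colon _ (iS _ q iI)); apply: sub_idealsumr.
- apply: ilenS (Ca q) => //; [exact: iS|exact/idealadd_ideal/iS|].
  apply: idealsum_sub; first exact/idealadd_ideal/iS.
    by apply: (@adjoinS A A^o) => y Iy; apply: sub_idealsuml.
  by move=> y Jy; apply: sub_idealadd; apply: sub_idealsumr.
- exact: Db.
Qed.

(** Over a prime P other than m, any x in m outside P drops the dimension by
    one; as some power of x lies in J, the power of x that lies in the q-th
    Frobenius power of J is linear in q, which costs one factor q. *)
Lemma length_growth J k I :
  is_ideal J -> (forall x, m x -> exists n, J (x ^+ n)) ->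
  is_ideal I -> ~ prime_chain I k.+1 -> bounded_growth J k I.
Proof.
move=> iJ nilJ; have im := local_ideal.
have iF q : is_ideal (frobenius_power J q) := ideal_gen_ideal _.
elim: k I => [|k IH] I iI noI; apply: growth_primes => // P [iP nP1 Pprime] IP.
all: have {}noI := contra_not (prime_chainS IP) noI.
all: have Pm := sub_local iP nP1.
all: have iS q : is_ideal (idealsum P (frobenius_power J q)) by exact: idealsum_ideal.
all: have [mP|/existsNP[x /not_implyP[mx nPx]]] := pselect (m `<=` P).
- exists 1%N => q; rewrite mul1n; apply: ilen_residue => // y /mP Py.
  exact: sub_idealsuml.
- case: noI; apply: (@prime_chain_cons _ m) => //; last first.
    by exists (fun=> m); split=> // i _; apply: local_prime.
  by split=> // /(_ _ mx).
- exists 1%N => q; case: q => [|q].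
    rewrite exp0n // muln0; apply: ilen0 => //; apply: sub_idealsumr => //.
    by apply: sub_ideal_gen; exists 0; [exact: ideal0|rewrite expr0].
  apply: (ilen_mono (k := 1)) => //; first by rewrite mul1n expn_gt0.
  by apply: ilen_residue => // y /mP Py; apply: sub_idealsuml.
- have iPx := idealadd_ideal x iP.
  have [|C HC] := IH _ iPx.
    by apply: contra_not noI; apply: prime_chain_cons => //; apply: proper_idealadd.
  have [n Jxn] := nilJ x mx; exists (n * C)%N => q.
  have -> : (n * C * q ^ k.+1 = (n * q) * (C * q ^ k))%N by rewrite expnS; lia.
  apply: (@ilen_pow _ _ im _ x) => //.
    apply: sub_idealsumr => //; rewrite exprM; apply: sub_ideal_gen.
    by exists (x ^+ n).
  apply: ilenS (HC q) => //; [exact: idealsum_ideal|exact: idealadd_ideal|].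
  apply: idealsum_sub; first exact: idealadd_ideal.
    by apply: (@adjoinS A A^o) => y Iy; apply: sub_idealsuml.
  by move=> y Jy; apply: sub_idealadd; apply: sub_idealsumr.
Qed.

End LocalRing.

(** * Hilbert's basis theorem and the Artin-Rees lemma *)

Lemma noetherian_acc (A : comNzRingType) (c : nat -> set A) : noetherian A ->
  (forall n, is_ideal (c n)) -> (forall n, c n `<=` c n.+1) ->
  exists n, c n.+1 `<=` c n.
Proof.
move=> noethA ic cS.
have IH : forall I : set A, is_ideal I -> forall n, I = c n -> exists n, c n.+1 `<=` c n.
  apply: noetherian_ind => // I iI IH n eI.
  have [?|nc] := pselect (c n.+1 `<=` c n); first by exists n.
  by apply: IH (erefl (c n.+1)); rewrite // eI; split.
exact: IH (ic 0%N) 0%N erefl.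
Qed.

(** If I were not finitely generated, one could choose polynomials
    f 0, f 1, and so on in I, each of least size outside the ideal generated
    by the previous ones; the leading coefficient of some f n is a combination
    of the previous leading coefficients, which contradicts that choice. *)
Lemma hilbert_basis (A : comNzRingType) : noetherian A -> noetherian {poly A}.
Proof.
move=> noethA I iI; apply: contrapT => noI.
have next (s : seq {poly A}) : {f | [set` s] `<=` I ->
    [/\ I f, ~ ideal_gen [set` s] f &
    forall g, I g -> (size g < size f)%N -> ideal_gen [set` s] g]}.
  apply: cid; have [sI|?] := pselect ([set` s] `<=` I); last by exists 0.
  have [f0 [If0 nsf0]] : exists f, I f /\ ~ ideal_gen [set` s] f.
    apply: contrapT => nof; apply: noI; exists s; apply/seteqP; split; last first.
      exact: ideal_gen_sub.
    by move=> f If; apply: contrapT => nsf; apply: nof; exists f.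
  have : exists n, `[< exists f, [/\ I f, ~ ideal_gen [set` s] f & size f = n] >].
    by exists (size f0); apply/asboolP; exists f0.
  move/ex_minnP => [n /asboolP[f [If nsf <-]] minf]; exists f => _; split=> // g Ig ltgf.
  apply: contrapT => nsg; suff : (size f <= size g)%N by rewrite leqNgt ltgf.
  by apply: minf; apply/asboolP; exists g.
pose l := fix l n := if n is n'.+1 then sval (next (l n')) :: l n' else [::].
pose f n := sval (next (l n)).
have lI n : [set` l n] `<=` I.
  elim: n => [|n IH] g //=; rewrite inE => /predU1P[->|/IH//].
  by have [] := svalP (next (l n)) IH.
have fP n := svalP (next (l n)) (lI n).
have il n : is_ideal (ideal_gen [set` l n]) := ideal_gen_ideal _.
have lM i j : (i <= j)%N -> {subset l i <= l j}.
  move=> /subnK <-; elim: (j - i)%N => // k IH g /IH gl.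
  by rewrite addSn /= inE gl orbT.
have fl i j : (i < j)%N -> f i \in l j.
  by move=> /lM; apply; rewrite /= inE eqxx.
have size_f i j : (i <= j)%N -> (size (f i) <= size (f j))%N.
  rewrite leq_eqVlt => /predU1P[->//|ltij]; rewrite leqNgt; apply/negP => ltf.
  have [Ifj nfj _] := fP j; have [_ _ /(_ _ Ifj ltf) lifj] := fP i.
  apply: nfj; apply: (ideal_gen_sub (il j) _ lifj) => g /(lM _ _ (ltnW ltij)) gl.
  exact: mem_ideal_gen.
pose lc n := lead_coef (f n).
pose c n := ideal_gen [set lc i | i in [set i | (i < n)%N]].
have [|n|n cn] := @noetherian_acc A c noethA; first by move=> n; exact: ideal_gen_ideal.
  apply: ideal_gen_sub; first exact: ideal_gen_ideal.
  by move=> _ [i /= lt_in <-]; apply: sub_ideal_gen; exists i => //=; apply: ltnW.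
have {cn} lcn : c n (lc n) by apply: cn; apply: sub_ideal_gen; exists n => /=.
have [Ifn nfn minfn] := fP n.
have fn_gt0 : (0 < size (f n))%N.
  by rewrite lt0n size_poly_eq0; apply/eqP => f0; apply: nfn; rewrite -/(f n) f0; apply: ideal0 (il _).
pose d := (size (f n)).-1.
pose T : set A := [set a | exists g,
  [/\ ideal_gen [set` l n] g, (size g <= size (f n))%N & g`_d = a]].
have iT : is_ideal T.
  split; first by exists 0; split; rewrite ?size_poly0 ?coef0 //; apply: ideal0.
  move=> a _ _ [g [lg sg <-]] [h [lh sh <-]]; exists (a%:P * g + h); split.
  - by apply: (idealD (il n)) => //; apply: (idealM _ (il n)).
  - rewrite (leq_trans (size_polyD _ _)) // geq_max sh andbT mul_polyC.
    exact: leq_trans (size_scale_leq _ _) sg.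
  - by rewrite coefD coefCM.
have [g [lg sg gd]] : T (lc n).
  apply: (ideal_gen_sub iT _ lcn) => _ [i /= lt_in <-].
  have sfi := size_f _ _ (ltnW lt_in).
  have fi_gt0 : (0 < size (f i))%N.
    have [_ nfi _] := fP i; rewrite lt0n size_poly_eq0; apply/eqP => f0; apply: nfi.
    by rewrite -/(f i) f0; apply: ideal0 (il _).
  exists ('X^(size (f n) - size (f i)) * f i); split.
  - by apply: (idealM _ (il n)); apply: mem_ideal_gen; apply: fl.
  - rewrite (leq_trans (size_polyMleq _ _)) // size_polyXn addSn /=.
    by rewrite subnK.
  - have arith (u v : nat) : (0 < v <= u -> (u - v <= u.-1) /\ (u.-1 - (u - v) = v.-1))%N by lia.
    have [le_d eq_d] := arith (size (f n)) (size (f i)) (introT andP (conj fi_gt0 sfi)).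
    by rewrite coefXnM /d ltnNge le_d /= eq_d.
have Ig : I g by apply: ideal_gen_sub lg => //; apply: lI.
apply: nfn; rewrite -[sval _](subrK g); apply: (idealD (il n)) => //.
apply: minfn; first exact: idealB.
apply: (@leq_ltn_trans d); last by rewrite /d prednK.
rewrite -/(f n); apply/leq_sizeP => j; rewrite leq_eqVlt => /predU1P[<-|lt_dj].
  by rewrite coefB gd /lc lead_coefE subrr.
have sj : (size (f n) <= j)%N by apply: leq_trans (leqSpred _) lt_dj.
by rewrite coefB !nth_default ?subrr //; apply: leq_trans sg _.
Qed.

(** A Noetherian cover of the Rees algebra, the subring of A[X] of the
    polynomials whose i-th coefficient lies in I ^ i: one variable of a
    polynomial ring over A is sent to x X for each generator x of I. *)
Lemma rees_cover (A : comNzRingType) (I : set A) (xs : seq A) : noetherian A ->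
  (forall x, x \in xs -> I x) ->
  exists (B : comNzRingType) (g : {rmorphism B -> {poly A}}),
  [/\ noetherian B, forall a, exists b, g b = a%:P,
      forall x, x \in xs -> exists b, g b = x *: 'X &
      forall b i, ideal_pow I i (g b)`_i].
Proof.
move=> noethA; elim: xs => [_|x xs IH xsI].
  exists A, (polyC : {rmorphism A -> {poly A}}); split=> // [a|a i]; first by exists a.
  rewrite coefC; case: eqP => [->//|_]; exact: ideal0 (ideal_pow_ideal _ _).
have [|B [g [noethB gC gX gI]]] := IH; first by move=> y ys; apply: xsI; rewrite inE ys orbT.
have cg : commr_rmorph g (x *: 'X) by move=> b; apply: mulrC.
exists {poly B}, (horner_morph cg); split.
- exact: hilbert_basis.
- by move=> a; have [b <-] := gC a; exists b%:P; rewrite /= horner_morphC.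
- move=> y; rewrite inE => /predU1P[->|/gX[b <-]]; first by exists 'X; rewrite /= horner_morphX.
  by exists b%:P; rewrite /= horner_morphC.
- elim/poly_ind => [|p b IHp] i; first by rewrite rmorph0 coef0; apply: ideal0 (ideal_pow_ideal _ _).
  rewrite rmorphD rmorphM /= horner_morphC horner_morphX coefD -scalerAr coefZ coefMX.
  apply: (idealD (ideal_pow_ideal _ _)) (gI b i).
  case: i => [|i] /=; first by [].
  by apply: ideal_powS => //; apply: xsI; apply: mem_head.
Qed.

(** The Artin-Rees lemma for a principal ideal (y) in the quotient of A by the
    prime ideal Q: lift the Rees algebra of I to a Noetherian ring B; the
    elements of B whose coefficients all lie in Q + (y) form an ideal, and k
    bounds the degrees of finitely many generators of this ideal. *)
Lemma artin_rees (A : comNzRingType) (I Q : set A) (y : A) : noetherian A ->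
  is_ideal I -> is_prime_ideal Q -> ~ Q y ->
  exists k, forall n b, idealsum Q (ideal_pow I (n + k)) (b * y) ->
    idealsum Q (ideal_pow I n) b.
Proof.
move=> noethA iI [iQ _ Qprime] nQy.
have [xs eI] := noethA I iI.
have xsI x : x \in xs -> I x by move=> xxs; rewrite eI; apply: sub_ideal_gen.
have [B [g [noethB gC gX gI]]] := rees_cover noethA xsI.
have iP n := ideal_pow_ideal I n.
have gIn n a : ideal_pow I n a -> exists b, g b = a *: 'X^n.
  elim: n a => [|n IH] a; first by have [b gb] := gC a; exists b; rewrite gb expr0 alg_polyC.
  have iT (T : A -> {poly A}) : (forall a u v, T (a * u + v) = a%:P * T u + T v) -> T 0 = 0 ->
      is_ideal [set u | exists b, g b = T u].
    move=> Tl T0; split; first by exists 0; rewrite rmorph0 T0.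
    move=> c u v [b bu] [b' bv]; have [d gd] := gC c; exists (d * b + b').
    by rewrite rmorphD rmorphM gd bu bv Tl.
  have iX k : is_ideal [set u | exists b, g b = u *: 'X^k].
    by apply: iT => [c u v|]; rewrite ?scale0r // scalerDl mul_polyC scalerA.
  apply: (ideal_gen_sub (iX n.+1)).
  move=> _ [x Ix [v /IH[b gb] <-]] /=.
  have [c gc] : exists c, g c = x *: 'X.
    by rewrite eI in Ix; apply: (ideal_gen_sub (iX 1%N) _ Ix) => u /gX.
  by exists (c * b); rewrite rmorphM gc gb -scalerAl -scalerAr -exprS scalerA.
pose Qy := idealadd Q y; have iQy : is_ideal Qy := idealadd_ideal y iQ.
pose M : set B := [set F | forall i, Qy (g F)`_i].
have iM : is_ideal M.
  split; first by move=> i; rewrite rmorph0 coef0; apply: ideal0.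
  move=> G F F' QF QF' i; rewrite rmorphD rmorphM coefD coefM; apply: idealD => //.
  by apply: ideal_sum => // j _; apply: idealM.
have [s eM] := noethB M iM.
pose k := (\max_(F <- s) size (g F))%N.
exists k => n b [q Qq Iaq]; pose a := b * y - q.
have [F gF] := gIn _ _ Iaq.
pose W (i : nat) : set A := [set c | exists2 d, ideal_pow I (i - k) d & Q (c - d * y)].
have iW i : is_ideal (W i).
  split; first by exists 0; [exact: ideal0|rewrite mul0r subrr; apply: ideal0].
  move=> c u v [d Id Qd] [d' Id' Qd']; exists (c * d + d').
    by apply: idealD => //; apply: idealM.
  have -> : c * u + v - (c * d + d') * y = c * (u - d * y) + (v - d' * y) by ring.
  by apply: idealD => //; apply: idealM.
have MF : M F.
  move=> i; rewrite gF coefZ coefXn; case: eqP => _; last by rewrite mulr0; apply: ideal0.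
  rewrite mulr1; exists b.
  have -> : b * y - q - b *: (y : A^o) = -1 * q by rewrite -[b *: (y : A^o)]/(b * y); ring.
  exact: idealM.
have [d Id Qd] : W (n + k)%N a.
  (* T is an ideal, as multiples are built in, so that only the generators of M,
     whose degrees are less than k, have to be checked. *)
  pose T : set B := [set F | forall G i, W i (g (G * F))`_i].
  have iT : is_ideal T.
    split=> [G i|c u v Tu Tv G i]; first by rewrite mulr0 rmorph0 coef0; apply: ideal0.
    by rewrite mulrDr mulrA rmorphD coefD; apply: idealD.
  have : T F.
    rewrite eM in MF; apply: (ideal_gen_sub iT _ MF) => H sH G i.
    rewrite rmorphM coefM; apply: ideal_sum => // j _.
    have [lt_ij|le_ji] := leqP k (i - j)%N.
      rewrite [X in _ * X]nth_default ?mulr0; first exact: ideal0.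
      by apply: leq_trans lt_ij; rewrite /k; apply: (@leq_bigmax_seq _ _ (fun=> true) (fun F => size (g F))).
    have [c Qc] : Qy (g H)`_(i - j) by suff : M H by []; rewrite eM; apply: mem_ideal_gen.
    exists ((g G)`_j * c).
      rewrite mulrC; apply: idealM => //.
      by apply: ideal_pow_leq (gI G j); have := ltn_ord j; lia.
    by rewrite -mulrA -mulrBr; apply: idealM.
  by move=> /(_ 1 (n + k)%N); rewrite mul1r gF coefZ coefXn eqxx mulr1.
rewrite addnK in Id; exists (b - d); last by rewrite opprB addrC subrK.
suff : Q ((b - d) * y) by case/Qprime.
have -> : (b - d) * y = (a - d * y) + q by rewrite /a; ring.
exact: idealD.
Qed.

(** * Finiteness of the dimension *)

Section FiniteDimension.
Variables (A : comNzRingType) (m : set A).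
Hypotheses (A_noeth : noetherian A) (A_local : is_local m).
Implicit Types (I J N P : set A) (x y a : A).

Let m_ideal : is_ideal m := local_ideal A_local.
Let m_field := local_field A_noeth A_local.
Let pow_ideal n : is_ideal (ideal_pow m n) := ideal_pow_ideal m n.

Lemma len_ideal_le I k : is_ideal I -> ilen m I k ->
  (len (I : set A^o) setT <= k)%N.
Proof. by move=> iI; apply: len_le. Qed.

Lemma ilen_len I k : is_ideal I -> ilen m I k -> ilen m I (len (I : set A^o) setT).
Proof. by move=> iI; apply: lle_len. Qed.

Lemma len_antimono I J k : is_ideal I -> is_ideal J -> I `<=` J -> ilen m I k ->
  (len (J : set A^o) setT <= len (I : set A^o) setT)%N.
Proof.
move=> iI iJ IJ Ik; apply: len_ideal_le => //.
by apply: (ilenS m_ideal iI iJ IJ); apply: ilen_len Ik.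
Qed.

Lemma len_split I x k : is_ideal I -> ilen m I k ->
  (len (I : set A^o) setT =
    len (I : set A^o) (idealadd I x) + len (idealadd I x : set A^o) setT)%N.
Proof.
move=> iI Ik; have iC := colon_ideal x iI; have iIx := idealadd_ideal x iI.
have Ix : ilen m (idealadd I x) k by apply: ilenS Ik => //; apply: sub_idealadd.
have Ck : ilen m (colon I x) k by apply: ilenS Ik => //; apply: sub_colon.
exact: (@lenD _ m m_field A^o I _ _ _ _ iI (lle_idealadd m_ideal iI iC (fun y Cy => Cy) Ck) Ix).
Qed.

(** Multiplication by x carries strict chains above I : x to strict chains
    between I and I + (x). *)
Lemma len_colon I x k : is_ideal I -> ilen m I k ->
  (len (colon I x : set A^o) setT <= len (I : set A^o) (idealadd I x))%N.
Proof.
move=> iI Ik; have iC := colon_ideal x iI.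
have Ck : ilen m (colon I x) k by apply: ilenS Ik => //; apply: sub_colon.
have [_ _ [c [c1 c2]]] := @lle_len_spec _ m m_field A^o _ _ _ iC Ck.
apply: (@schain_len _ m m_field A^o _ _ _ _ iI (lle_idealadd m_ideal iI iC (fun y Cy => Cy) Ck)).
pose c' i : set A := [set w | exists2 v, c i v & I (w - v * x)].
have cc' i v : (i <= len (colon I x : set A^o) setT)%N -> c i v <-> c' i (v * x).
  move=> /c1[si Ci _]; split=> [cv|[u cu Iuv]].
    by exists v => //; rewrite subrr; apply: ideal0.
  by apply: (submodBr si _ cu); apply: Ci; rewrite /colon /mkset mulrBl.
exists c'; split=> i.
  move=> /c1[[c0 cl] Ci _]; split.
  - split; first by exists 0 => //; rewrite mul0r subrr; apply: ideal0.
    move=> a u v [s cs Is] [t ct It]; exists (a *: s + t); first exact: cl.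
    have -> : a *: u + v - (a *: s + t) * x = a * (u - s * x) + (v - t * x).
      by rewrite -[a *: u]/(a * u) -[a *: s]/(a * s); ring.
    by apply: idealD => //; apply: idealM.
  - by move=> u Iu; exists 0 => //; rewrite mul0r subr0.
  - by move=> u [v _ Iuv]; exists v.
move=> lt_i; have [cS ncS] := c2 i lt_i.
split=> [w [v /cS cv Iw]|s]; first by exists v.
by apply: ncS => v /(cc' _ _ lt_i)/s/cc'; apply; apply: ltnW.
Qed.

Definition hilbert_samuel P n : nat :=
  len (idealsum P (ideal_pow m n) : set A^o) setT.

(** By double induction on xs and n: killing x leaves one generator less, and
    the colon ideal of x contains I + m ^ (n - 1). *)
Lemma ilen_pow_gens (xs : seq A) I n : is_ideal I ->
  (forall x, x \in xs -> m x) -> m `<=` foldl (@idealadd A) I xs ->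
  ilen m (idealsum I (ideal_pow m n)) (n ^ size xs)%N.
Proof.
elim: xs I n => [|x xs IH] /= I n iI xsm mI.
  rewrite expn0; apply: ilen_residue; first exact: idealsum_ideal.
  by move=> x /mI; apply: sub_idealsuml.
have iIx := idealadd_ideal x iI.
have iS k L : is_ideal L -> is_ideal (idealsum L (ideal_pow m k)).
  by move=> iL; apply: idealsum_ideal.
elim: n => [|n IHn].
  by rewrite exp0n //; apply: ilen0; [apply: sub_idealsumr|apply: idealsum_ideal].
apply: (@ilen_mono _ m _ ((n.+1 ^ size xs) + n ^ (size xs).+1)); first exact: iS.
  rewrite !expnS mulSn leq_add2l leq_mul2l; apply/orP; right.
  by case: (size xs) => // k; rewrite leq_exp2r.
apply: (ilen_split m_ideal (x := x) (iS n.+1 I iI) (iS n I iI)); last exact: IHn.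
- move=> y [u Iu myu]; exists (u * x); first by rewrite mulrC; apply: idealM.
  by rewrite -mulrBl mulrC; apply: ideal_powS => //; apply: xsm; apply: mem_head.
- have xsm' y : y \in xs -> m y by move=> ys; apply: xsm; rewrite inE ys orbT.
  apply: ilenS (IH _ n.+1 iIx xsm' mI) => //; [exact: iS|exact/idealadd_ideal/iS|].
  apply: idealsum_sub; first exact/idealadd_ideal/iS.
    by apply: (@adjoinS A A^o) => y Iy; apply: sub_idealsuml.
  by move=> y Jy; apply: sub_idealadd; apply: sub_idealsumr.
Qed.

Lemma hilbert_samuel_poly :
  exists s, forall P n, is_ideal P ->
    ilen m (idealsum P (ideal_pow m n)) (n ^ s)%N.
Proof.
have [xs em] := A_noeth m_ideal; exists (size xs) => P n iP.
have foldS L (ys : seq A) : L `<=` foldl (@idealadd A) L ys.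
  by elim: ys L => [|y ys IH] L //=; apply: subset_trans (IH _); apply: sub_idealadd.
have fold_ideal (ys : seq A) L : is_ideal L -> is_ideal (foldl (@idealadd A) L ys).
  by elim: ys L => [|y ys IH] L iL //=; apply/IH/idealadd_ideal.
have xsm x : x \in xs -> m x by move=> xxs; rewrite em; apply: mem_ideal_gen.
apply: ilen_pow_gens => //; rewrite em; apply: ideal_gen_sub; first exact: fold_ideal.
move=> x /=; elim: xs {em xsm} P iP => //= y xs IH P iP; rewrite inE => /predU1P[->|xxs].
  by apply: foldS; apply: mem_idealadd.
by apply: IH => //; apply: idealadd_ideal.
Qed.

(** Multiplication by an element y of P' outside P on A / (P + m ^ (n + k)): the
    cokernel is at least as long as A / (P' + m ^ (n + k)), and, by Artin-Rees,
    the image is at least as long as A / (P + m ^ n). *)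
Lemma hilbert_samuel_drop P P' : is_prime_ideal P -> is_prime_ideal P' -> P `<` P' ->
  exists k, forall n, (hilbert_samuel P n + hilbert_samuel P' (n + k) <=
    hilbert_samuel P (n + k))%N.
Proof.
move=> pP [iP' P'1 _] [PP' /existsNP[y /not_implyP[P'y nPy]]].
have iP : is_ideal P by case: pP.
have [s HS] := hilbert_samuel_poly.
have [k AR] := artin_rees A_noeth m_ideal pP nPy; exists k => n.
have iS j L : is_ideal L -> is_ideal (idealsum L (ideal_pow m j)).
  by move=> iL; apply: idealsum_ideal.
have Hk := HS P (n + k)%N iP.
rewrite [X in (_ <= X)%N](len_split y (iS _ _ iP) Hk) leq_add //.
  apply: leq_trans (len_colon y (iS _ _ iP) Hk).
  apply: (len_antimono (k := ((n + k) ^ s)%N)).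
  - exact/colon_ideal/iS.
  - exact: iS.
  - by move=> b; apply: AR.
  - by apply: ilenS Hk => //; [exact: iS|exact/colon_ideal/iS|apply: sub_colon; apply: iS].
apply: (len_antimono (k := ((n + k) ^ s)%N)).
- exact/idealadd_ideal/iS.
- exact: iS.
- apply: idealadd_sub; first exact: iS.
    by apply: idealsumS.
  exact: sub_idealsuml.
- by apply: ilenS Hk => //; [exact: iS|exact/idealadd_ideal/iS|apply: sub_idealadd].
Qed.

Lemma hilbert_samuel_mono P i j : is_ideal P -> (i <= j)%N ->
  (hilbert_samuel P i <= hilbert_samuel P j)%N.
Proof.
move=> iP le_ij; have [s HS] := hilbert_samuel_poly.
apply: (len_antimono _ _ _ (HS P j iP)); try exact: idealsum_ideal.
by apply: idealsumS => //; apply: ideal_pow_leq.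
Qed.

Lemma hilbert_samuel_pos P n : is_ideal P -> P `<=` m -> (0 < hilbert_samuel P n.+1)%N.
Proof.
move=> iP Pm; rewrite lt0n; apply/eqP => h0; have [s HS] := hilbert_samuel_poly.
have iS : is_ideal (idealsum P (ideal_pow m n.+1)) by apply: idealsum_ideal.
have := ilen_len iS (HS P n.+1 iP); rewrite -/(hilbert_samuel _ _) h0.
move=> H; apply: (local_proper A_local).
suff /(_ 1) : idealsum P (ideal_pow m n.+1) `<=` m.
  by apply; inversion H as [e|]; rewrite e.
apply: idealsum_sub => //; rewrite -{2}(ideal_pow1 m_ideal); exact: ideal_pow_leq.
Qed.

(** The drop inequality along n, n + k, up to n + n k gives
    n l_P'(n) <= l_P (n (1 + k)), so that the degree of growth of the
    Hilbert-Samuel function drops strictly from P to P'. *)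
Lemma prime_chain_growth j P C : is_prime_ideal P ->
  (forall n, hilbert_samuel P n <= C * n ^ j)%N -> ~ prime_chain P j.+1.
Proof.
elim: j P C => [|j IH] P C pP HP [c [cp Pc cS]].
all: have [iP _ _] := pP; have pc1 := cp 1%N isT; have [ic1 c11 _] := pc1.
all: have Pc1 : P `<` c 1%N by
  case: (cS 0%N isT) => cc ncc; split=> [x /Pc /cc //|s]; apply: ncc => x /s /Pc.
all: have c1m := sub_local A_noeth A_local ic1 c11.
all: have [k drop] := hilbert_samuel_drop pP pc1 Pc1.
all: have sumdrop n i : (i * hilbert_samuel (c 1%N) n <= hilbert_samuel P (n + i * k))%N by
  elim: i => // i IHi; rewrite (_ : n + i.+1 * k = n + i * k + k)%N; [rewrite mulSn addnC|lia];
  apply: leq_trans (drop _); rewrite leq_add //; apply: hilbert_samuel_mono => //; lia.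
- have := leq_trans (sumdrop C.+1 C.+1) (HP _); rewrite expn0 muln1 leqNgt => /negP; apply.
  by rewrite -[X in (X < _)%N]muln1 (leq_trans _ (leq_mul (leqnn _) (hilbert_samuel_pos C ic1 c1m))) // !muln1.
- apply: (IH (c 1%N) (C * (1 + k) ^ j.+1)%N pc1); last first.
    by exists (fun i => c i.+1); split=> [i|x|i]; [apply: (cp i.+1)| |apply: (cS i.+1)].
  case=> [|n].
    have [s HS] := hilbert_samuel_poly.
    apply: leq_trans (len_ideal_le _ (ilen0 m _ _)) _ => //; try exact: idealsum_ideal.
    exact: sub_idealsumr.
  rewrite -(leq_pmul2l (ltn0Sn n)).
  apply: leq_trans (sumdrop _ _) _; apply: leq_trans (HP _) _.
  rewrite mulnCA -expnS -mulnA leq_mul2l -expnMn; apply/orP; right.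
  by rewrite leq_exp2r //; lia.
Qed.

Lemma prime_chain_bound : exists s, forall P, is_prime_ideal P -> ~ prime_chain P s.+1.
Proof.
have [s HS] := hilbert_samuel_poly; exists s => P pP; have [iP _ _] := pP.
apply: (@prime_chain_growth _ _ 1) => // n; rewrite mul1n; apply: len_ideal_le => //.
  exact: idealsum_ideal.
exact: HS.
Qed.

Lemma prime_chain_leq I i j : (i <= j)%N -> prime_chain I j -> prime_chain I i.
Proof.
move=> le_ij [c [cp Ic cS]]; exists c; split=> // k lek; first exact/cp/(leq_trans lek).
exact/cS/(leq_trans lek).
Qed.

End FiniteDimension.

Lemma krull_dimE (A : comNzRingType) :
  krull_dim A = supremum 0%N [set n | prime_chain [set 0 : A] n].
Proof.
rewrite /krull_dim; congr supremum; apply/seteqP; split=> n [c].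
  move=> [cp cS]; exists c; split=> // _ ->; have [? _ _] := cp 0%N isT; exact: ideal0.
by move=> [cp _ cS]; exists c.
Qed.

Lemma krull_dim_max (R : idomainType) (m : set R) : noetherian R -> is_local m ->
  prime_chain [set 0 : R] (krull_dim R) /\ ~ prime_chain [set 0 : R] (krull_dim R).+1.
Proof.
move=> Rnoeth Rlocal.
have p0 : is_prime_ideal [set 0 : R].
  split; first by split=> // a x y -> ->; rewrite /mkset mulr0 addr0.
    exact/eqP/oner_neq0.
  by move=> x y /eqP; rewrite mulf_eq0 => /orP[] /eqP; [left|right].
have [s bnd] := prime_chain_bound Rnoeth Rlocal.
have H n : prime_chain [set 0 : R] n -> (n <= s)%N.
  by move=> ch; rewrite leqNgt; apply/negP => /prime_chain_leq/(_ ch); apply: bnd.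
have ch0 : prime_chain [set 0 : R] 0 by exists (fun=> [set 0 : R]); split=> [i|x|i] //.
have exP : exists n, `[< prime_chain [set 0 : R] n >] by exists 0%N; apply/asboolP.
have ubP n : `[< prime_chain [set 0 : R] n >] -> (n <= s)%N by move/asboolP; apply: H.
case: (ex_maxnP exP ubP) => d /asboolP chd maxd.
have -> : krull_dim R = d.
  by rewrite krull_dimE; apply: supremum_nat => // k chk; apply/maxd/asboolP.
by split=> // chd'; have := maxd d.+1; rewrite ltnn => /(_ (introT (asboolP _) chd')).
Qed.

(** * Lengths under restriction of scalars, and of products *)

(** B as an A-module through f; with f the Frobenius endomorphism of R, this is
    R as a module over its p-th powers. *)
Definition restr (A B : comNzRingType) (f : {rmorphism A -> B}) : Type := B.

Section RestrictionOfScalars.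
Variables (A B : comNzRingType) (f : {rmorphism A -> B}).

HB.instance Definition _ := GRing.Zmodule.on (restr f).

Definition restr_scale (a : A) (b : restr f) : restr f := (f a * b : B).

Fact restr_scaleA a b v : restr_scale a (restr_scale b v) = restr_scale (a * b) v.
Proof. by rewrite /restr_scale rmorphM mulrA. Qed.

Fact restr_scale1 : left_id 1 restr_scale.
Proof. by move=> v; rewrite /restr_scale rmorph1 mul1r. Qed.

Fact restr_scaleDr : right_distributive restr_scale +%R.
Proof. by move=> a u v; rewrite /restr_scale mulrDr. Qed.

Fact restr_scaleDl v : {morph restr_scale^~ v : a b / a + b}.
Proof. by move=> a b; rewrite /restr_scale rmorphD mulrDl. Qed.

HB.instance Definition _ := GRing.Zmodule_isLmodule.Build A (restr f)
  restr_scaleA restr_scale1 restr_scaleDr restr_scaleDl.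

Lemma restr_scaleE (a : A) (v : restr f) : a *: v = (f a * (v : B) : B).
Proof. by []. Qed.

Lemma ideal_submod (N : set B) : is_ideal N -> submod (N : set (restr f)).
Proof. by move=> iN; split=> [|a x y Nx Ny]; [exact: ideal0|apply: iN.2]. Qed.

Variables (mA : set A) (mB : set B).
Hypotheses (mA_field : forall a, ~ mA a -> exists b, mA (b * a - 1)).
Hypotheses (mB_field : forall a, ~ mB a -> exists b, mB (b * a - 1)).
Hypothesis f_local : forall a, mA a -> mB (f a).
Hypothesis f_residue : forall b, exists a, mB (b - f a).

(** As B is f A + mB, a cyclic B-module that is killed by mB is also generated
    over A by its generator. *)
Lemma lle_restr (N : set B) k : is_ideal N -> ilen mB N k ->
  lle mA (N : set (restr f)) setT k.
Proof.
move=> iN; have sN := ideal_submod iN.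
suff H (M : set B^o) : lle mB (N : set B^o) M k -> lle mA (N : set (restr f)) M k by exact: H.
elim=> [|{}M {}k x NM IH Mx]; first exact: lle0.
have sM := @lle_submod B mB B^o _ _ _ iN NM.
have -> : adjoin M x = adjoin (M : set (restr f)) x.
  apply/seteqP; split=> y [c My]; last by exists (f c).
  have [a ma] := f_residue c; exists a.
  have -> : y - a *: (x : restr f) = (y - c *: x) + (c - f a) *: x.
    by rewrite scalerBl addrA subrK.
  by apply: submodD => //; apply: Mx.
by apply: lleS => // a ma; apply: (Mx (f a)); apply: f_local.
Qed.

Lemma len_restr (N : set B) k : is_ideal N -> ilen mB N k ->
  len (N : set (restr f)) setT = len (N : set B^o) setT.
Proof.
move=> iN Nk; have sN := ideal_submod iN.
have [_ Nlen [c [c1 c2]]] := @lle_len_spec _ _ mB_field B^o _ _ _ iN Nk.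
apply/eqP; rewrite eqn_leq; apply/andP; split.
  exact: (len_le mA_field sN (lle_restr iN Nlen)).
apply: (schain_len mA_field sN (lle_restr iN Nlen)).
exists c; split=> // i /c1[sc Nc _]; split=> //; exact: ideal_submod.
Qed.
End RestrictionOfScalars.

Section Products.
Variables (A : comNzRingType) (m : set A).
Hypotheses (m_field : forall a, ~ m a -> exists b, m (b * a - 1)) (m0 : m 0).
Variables (V : lmodType A) (n : nat) (e : 'I_n -> V) (co : 'I_n -> V -> A).
Hypotheses (co_lin : forall i a, {morph co i : u v / a *: u + v >-> a * u + v}).
Hypotheses (co_e : forall i j, co i (e j) = (i == j)%:R).
Variables (I : 'I_n -> set A) (k : 'I_n -> nat).
Hypotheses (iI : forall i, is_ideal (I i)) (Ik : forall i, ilen m (I i) (k i)).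

Definition coord_prod : set V := [set v | forall i, I i (co i v)].

Let co0 i : co i 0 = 0.
Proof. by have := co_lin i (-1) 0 0; rewrite scaler0 addr0 mulN1r addNr. Qed.

Let coB i a u v : co i (u - a *: v) = co i u - a * co i v.
Proof. by rewrite [u + _]addrC -scaleNr co_lin mulNr [RHS]addrC. Qed.

Let coZ i a u : co i (a *: u) = a * co i u.
Proof. by rewrite -[_ *: _]addr0 co_lin co0 addr0. Qed.

Let part (j : nat) : set V := [set v | forall i : 'I_n, (i < j)%N -> I i (co i v)].

Let part_submod j : submod (part j).
Proof.
split=> [i _|a u v pu pv i lt_ij]; first by rewrite co0; apply: ideal0.
by rewrite co_lin; apply: idealD => //; [apply: idealM => //; apply: pu|apply: pv].
Qed.

(* Restricting the coordinates one at a time gives layers A / I i. *)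
Let part_step (i : 'I_n) l :
  lle m (I i : set A^o) setT l <-> lle m (part i.+1) (part i) l.
Proof.
split.
  apply: (@lle_linear _ _ A^o V (fun a => a *: e i)) => //.
  - by move=> a u v; rewrite scalerDl scalerA.
  - exact: iI.
  - move=> a Ia j; rewrite ltnS leq_eqVlt coZ co_e => /predU1P[eji|lt_ji].
      by rewrite (val_inj eji) eqxx mulr1.
    rewrite (_ : j == i = false) ?mulr0; first exact: ideal0.
    by apply/eqP => eji; rewrite eji ltnn in lt_ji.
  - move=> w; split=> [pw|[a _ pw] j lt_ji].
      exists (co i w) => // j; rewrite coB co_e ltnS leq_eqVlt => /predU1P[eji|lt_ji].
        by rewrite (val_inj eji) eqxx mulr1 subrr; apply: ideal0.
      rewrite (_ : j == i = false) ?mulr0 ?subr0; first exact: pw.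
      by apply/eqP => eji; rewrite eji ltnn in lt_ji.
    have := pw j (leqW lt_ji); rewrite coB co_e (_ : j == i = false) ?mulr0 ?subr0 //.
    by apply/eqP => eji; rewrite eji ltnn in lt_ji.
apply: (@lle_linear _ _ V A^o (co i)) => //.
- exact: iI.
- by move=> v pv; apply: pv.
- move=> w; split=> // _; exists (w *: e i); last first.
    have -> : w - co i (w *: e i) = 0 by rewrite coZ co_e eqxx mulr1 subrr.
    exact: (ideal0 (iI i)).
  move=> j lt_ji; rewrite coZ co_e (_ : j == i = false) ?mulr0; first exact: ideal0.
  by apply/eqP => eji; rewrite eji ltnn in lt_ji.
Qed.

Lemma len_prod :
  lle m coord_prod setT (\sum_i k i) /\
  len coord_prod setT = \sum_i len (I i : set A^o) setT.
Proof.
have H j : (j <= n)%N -> lle m (part j) setT (\sum_(i < n | (i < j)%N) k i) /\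
    len (part j) setT = \sum_(i < n | (i < j)%N) len (I i : set A^o) setT.
  elim: j => [_|j IH lt_jn].
    have -> : part 0 = setT by apply/seteqP; split.
    rewrite !big_pred0 //; split; first exact: lle0.
    by apply/eqP; rewrite -leqn0; apply: (len_le m_field _ (lle0 _ _)); apply: submodT.
  have [IH1 IH2] := IH (ltnW lt_jn); pose i0 := Ordinal lt_jn.
  have bigj (F : 'I_n -> nat) :
      (\sum_(i < n | (i < j.+1)%N) F i = F i0 + \sum_(i < n | (i < j)%N) F i)%N.
    rewrite (bigD1 i0) ?ltnSn //=; congr (_ + _)%N; apply: eq_bigl => i.
    by rewrite ltnS -val_eqE /= [in RHS]ltn_neqAle andbC.
  have step := (part_step i0 (k i0)).1 (Ik i0).
  split; first by rewrite bigj; apply: lle_trans step IH1.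
  rewrite (lenD m_field (part_submod _) step IH1) bigj IH2; congr (_ + _)%N.
  apply/eqP; rewrite eqn_leq; apply/andP; split.
    apply: (len_le m_field (part_submod _)).
    by apply/(part_step i0); apply: (@lle_len _ m m_field A^o _ _ _ (iI i0) (Ik i0)).
  apply: (@len_le _ m m_field A^o _ _ _ (iI i0)).
  by apply/(part_step i0); apply: (lle_len m_field (part_submod _) step).
have [H1 H2] := H n (leqnn n).
have -> : coord_prod = part n.
  by apply/seteqP; split=> v pv i => [_|]; apply: pv.
have bign (F : 'I_n -> nat) : (\sum_(i < n | (i < n)%N) F i = \sum_i F i)%N.
  by apply: eq_bigl => i; rewrite ltn_ord.
by move: H1 H2; rewrite !bign.
Qed.

End Products.

(** * Frobenius: finiteness and generic rank *)

Section FrobeniusFinite.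
Variables (R : idomainType) (m : set R) (kappa : closedFieldType).
Variables (pi : {rmorphism R -> kappa}) (p : nat).
Hypotheses (R_noeth : noetherian R) (R_local : is_local m).
Hypotheses (R_residue : residue_map m pi) (R_complete : complete_for m).
Hypothesis R_char : p \in [pchar R].
Implicit Types (I J N : set R) (x y : R).

Let m_ideal : is_ideal m := local_ideal R_local.
Let p_gt0 : (0 < p)%N.
Proof. by move: R_char; rewrite inE => /andP[/prime_gt0]. Qed.
Let frob : {rmorphism R -> R} := pFrobenius_aut R_char.
Let frobE x : frob x = x ^+ p. Proof. by []. Qed.

Lemma exprpD x y : (x + y) ^+ p = x ^+ p + y ^+ p.
Proof. by rewrite -!frobE rmorphD. Qed.

Lemma exprpB x y : (x - y) ^+ p = x ^+ p - y ^+ p.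
Proof. by rewrite -!frobE rmorphB. Qed.

Lemma residue_perfect x : exists a, m (x - a ^+ p).
Proof.
have [pi_surj pi_ker] := R_residue.
have [c hc] : exists c : kappa, c ^+ p = pi x.
  have /closed_rootP[c] : size ('X^p - (pi x)%:P : {poly kappa}) != 1%N.
    by rewrite size_XnsubC // eqSS -lt0n.
  by rewrite rootE !hornerE subr_eq0 => /eqP; exists c.
have [a ea] := pi_surj c; exists a.
by rewrite -pi_ker /= rmorphB rmorphXn ea hc subrr.
Qed.

Definition pcomb (u : seq R) (a : nat -> R) : R := \sum_(i < size u) a i ^+ p * u`_i.

Lemma pcombD u (a b : nat -> R) : pcomb u (fun i => a i + b i) = pcomb u a + pcomb u b.
Proof. by rewrite -big_split; apply: eq_bigr => i _; rewrite exprpD mulrDl. Qed.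

Lemma pcombB u (a b : nat -> R) : pcomb u (fun i => a i - b i) = pcomb u a - pcomb u b.
Proof. by rewrite -sumrB; apply: eq_bigr => i _; rewrite exprpB mulrBl. Qed.

Lemma pcombZ u (a : nat -> R) c : pcomb u (fun i => c * a i) = c ^+ p * pcomb u a.
Proof. by rewrite mulr_sumr; apply: eq_bigr => i _; rewrite exprMn mulrA. Qed.

Lemma pcomb0 u : pcomb u (fun=> 0) = 0.
Proof. by rewrite /pcomb big1 // => i _; rewrite expr0n gtn_eqF // mul0r. Qed.

(** A scalar c acts on a layer killed by m like a p-th power, because the residue
    field is perfect. *)
Lemma pcomb_lle N M k : is_ideal N -> lle m (N : set R^o) M k ->
  exists u, forall x, M x -> exists a, N (x - pcomb u a).
Proof.
move=> iN; elim=> [|{}M {}k y NM [u Hu] My].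
  by exists [::] => x Nx; exists (fun=> 0); rewrite pcomb0 subr0.
have sM := @lle_submod R m R^o _ _ _ iN NM.
exists (y :: u) => x [c Mxc]; have [b mb] := residue_perfect c.
have [] := Hu (x - b ^+ p * y).
  have -> : x - b ^+ p * y = (x - c * y) + (c - b ^+ p) * y by ring.
  by apply: (submodD sM) => //; apply: My.
move=> a Na; exists (fun i => if i is i'.+1 then a i' else b).
by rewrite /pcomb big_ord_recl opprD addrA.
Qed.

Lemma separated x : (forall n, ideal_pow m n x) -> x = 0.
Proof.
have [n|y [_ uniq]] := @R_complete (fun=> 0).
  by rewrite subrr; apply: ideal0 (ideal_pow_ideal _ _).
move=> mx; have <- : y = x by apply: uniq => n; rewrite subr0.
by apply: uniq => n; rewrite subr0; apply: ideal0 (ideal_pow_ideal _ _).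
Qed.

(** A finite set u that spans R over its p-th powers modulo the Frobenius power
    m^[p] spans R: the coefficients of x are found by successive
    approximations in the powers of m, which converge because R is complete. *)
Lemma frobenius_finite : exists u, forall x, exists a, x = pcomb u a.
Proof.
have i0 : is_ideal [set 0 : R].
  by split=> // a x y -> ->; rewrite /mkset mulr0 addr0.
have iF q : is_ideal (frobenius_power m q) := ideal_gen_ideal _.
have [_ nochain] := krull_dim_max R_noeth R_local.
have [|C HC] := length_growth R_noeth R_local m_ideal _ i0 nochain.
  by move=> x mx; exists 1%N; rewrite expr1.
have Fp : ilen m (frobenius_power m p) (C * p ^ krull_dim R)%N.
  apply: ilenS (HC p) => //; first exact: idealsum_ideal.
  by apply: idealsum_sub => // _ ->; apply: ideal0.
have [u Hu] := pcomb_lle (iF p) Fp; exists u => x0.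
pose E n : set R := frobenius_power (ideal_pow m n) p.
have iE n : is_ideal (E n) := ideal_gen_ideal _.
have iP n := ideal_pow_ideal m n.
have EP n : E n `<=` ideal_pow m n.
  apply: ideal_gen_sub => // _ [g mg <-]; rewrite -(prednK p_gt0) exprSr.
  exact: idealM.
(* The n-th correction has its coefficients in the p-th powers of m ^ n. *)
have step n x : E n x -> exists h,
    (forall i, ideal_pow m n (h i)) /\ E n.+1 (x - pcomb u h).
  pose T := [set x | exists h, (forall i, ideal_pow m n (h i)) /\ E n.+1 (x - pcomb u h)].
  have TD y z : T y -> T z -> T (y + z).
    move=> [h [mh Eh]] [l [ml El]]; exists (fun i => h i + l i).
    split=> [i|]; first by apply: idealD.
    by rewrite pcombD opprD addrACA; apply: (idealD (iE _)).
  have T0 : T 0.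
    exists (fun=> 0); split=> [i|]; first exact: ideal0.
    by rewrite pcomb0 subr0; apply: ideal0 (iE _).
  have iT : is_ideal [set x | forall a, T (a * x)].
    split=> [a|c y z Ty Tz a]; first by rewrite mulr0.
    by rewrite mulrDr mulrA; apply: TD.
  move=> Ex; rewrite -[x]mul1r; move: x Ex (1 : R); apply: (ideal_gen_sub iT).
  move=> _ [g mg <-] a; have [b Fb] := Hu a I.
  exists (fun i => g * b i); split=> [i|]; first by rewrite mulrC; apply: idealM.
  rewrite pcombZ mulrC -mulrBr.
  have iL : is_ideal [set w | E n.+1 (g ^+ p * w)].
    split; rewrite /mkset; first by rewrite mulr0; apply: ideal0 (iE _).
    move=> c y z Ey Ez; rewrite mulrDr mulrCA; apply: (idealD (iE _)) => //.
    exact: (idealM _ (iE _)).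
  apply: (ideal_gen_sub iL _ Fb) => _ [l ml <-]; rewrite /mkset -exprMn mulrC.
  by apply: sub_ideal_gen; exists (l * g) => //; apply: ideal_powS.
have next n (x : R) : {h : nat -> R | E n x ->
    (forall i, ideal_pow m n (h i)) /\ E n.+1 (x - pcomb u h)}.
  apply: cid; have [/step[h Hh]|?] := pselect (E n x); first by exists h.
  by exists (fun=> 0).
pose X := fix X n := if n is n'.+1 then X n' - pcomb u (sval (next n' (X n'))) else x0.
pose h n := sval (next n (X n)).
have EX n : E n (X n).
  elim: n => [|n IH]; last by have [] := svalP (next n (X n)) IH.
  by rewrite /E /= -[x0]mulr1; apply: (idealM _ (iE 0%N)); apply: sub_ideal_gen; exists 1; rewrite ?expr1n.
have mh n i : ideal_pow m n (h n i) by apply: (proj1 (svalP (next n (X n)) (EX n))).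

pose H n i := \sum_(j < n) h j i.
have XH n : X n = x0 - pcomb u (H n).
  elim: n => [|n IH] /=.
    rewrite (_ : H 0%N = fun=> 0) ?pcomb0 ?subr0 //.
    by apply/funext => i; rewrite /H big_ord0.
  rewrite -/(h n) IH -addrA -opprD -pcombD; congr (_ - pcomb _ _).
  by apply/funext => i; rewrite /H big_ord_recr.
have lim i : {y | forall n, ideal_pow m n (y - H n i)}.
  apply: cid; have [n|y [Hy _]] := @R_complete (fun n => H n i); last by exists y.
  by rewrite /H big_ord_recr /= [X in X - _]addrC addrK.
exists (fun i => sval (lim i)); apply/eqP; rewrite -subr_eq0; apply/eqP/separated => n.
have -> : x0 - pcomb u (fun i => sval (lim i)) =
    X n - pcomb u (fun i => sval (lim i) - H n i).
  by rewrite XH pcombB opprB addrA subrK.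
apply: idealB => //; first exact: EP.
apply: ideal_sum => // i _; rewrite mulrC; apply: idealM => //.
rewrite -(prednK p_gt0) exprSr; apply: idealM => //; exact: (svalP (lim i)).
Qed.

End FrobeniusFinite.

Section FrobeniusRank.
Variables (R : idomainType) (m : set R) (p : nat).
Hypotheses (R_noeth : noetherian R) (R_local : is_local m).
Hypothesis R_char : p \in [pchar R].
Hypothesis R_perfect : forall x : R, exists a, m (x - a ^+ p).
Variable u : seq R.
Hypothesis u_span : forall x, exists a, x = pcomb p u a.
Implicit Types (I J N : set R) (x y : R).

Let m_ideal : is_ideal m := local_ideal R_local.
Let m_field := local_field R_noeth R_local.
Let p_gt0 : (0 < p)%N.
Proof. by move: R_char; rewrite inE => /andP[/prime_gt0]. Qed.
Let frob : {rmorphism R -> R} := pFrobenius_aut R_char.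
Let s := size u.

Definition spcomb (S : {set 'I_s}) (v : 'rV[R]_s) : R :=
  \sum_(i in S) v 0 i ^+ p * u`_i.

Definition pindep (S : {set 'I_s}) : Prop :=
  forall v, spcomb S v = 0 -> forall i, i \in S -> v 0 i = 0.

Lemma spcombP S a v w : spcomb S (a *: v + w) = a ^+ p * spcomb S v + spcomb S w.
Proof.
rewrite /spcomb mulr_sumr -big_split; apply: eq_bigr => i _ /=.
by rewrite !mxE exprpD // exprMn mulrDl mulrA.
Qed.

Lemma spcomb0 S : spcomb S 0 = 0.
Proof. by rewrite /spcomb big1 // => i _; rewrite mxE expr0n gtn_eqF // mul0r. Qed.

Lemma spcombZ S a v : spcomb S (a *: v) = a ^+ p * spcomb S v.
Proof. by rewrite -[a *: v]addr0 spcombP spcomb0 addr0. Qed.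

Lemma exprN1p : (-1 : R) ^+ p = -1.
Proof.
by have := exprpB R_char 0 1; rewrite sub0r expr1n expr0n gtn_eqF // sub0r.
Qed.

(** A maximal subset S of u that is independent over the p-th powers is a basis
    of the fraction field over its p-th powers; c ^ p is a common denominator
    for the coordinates of the elements of u. *)
Lemma exists_frobenius_basis : exists (S : {set 'I_s}) (c : R),
  [/\ c != 0, pindep S & forall x, exists v, c ^+ p * x = spcomb S v].
Proof.
have indep0 : `[< pindep finset.set0 >] by apply/asboolP => v _ i; rewrite inE.
case: (@arg_maxnP _ finset.set0 (fun S : {set 'I_s} => `[< pindep S >]) (fun S => #|S|) indep0).
move=> S /asboolP indepS maxS; exists S.
have H (j : 'I_s) : {c : R | c != 0 /\ exists v, c ^+ p * u`_j = spcomb S v}.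
  apply: cid; have [jS|njS] := boolP (j \in S).
    exists 1; split; [exact: oner_neq0|exists (delta_mx 0 j)].
    rewrite /spcomb (bigD1 j) //= big1 => [|i /andP[_ ij]].
      by rewrite mxE !eqxx addr0 expr1n.
    by rewrite mxE (negPf ij) andbF expr0n gtn_eqF // mul0r.
  have : ~ pindep (j |: S)%SET.
    move/asboolP/maxS; rewrite cardsU1 njS add1n /= => le; by have := le; rewrite ltnn.
  move=> /existsNP[v /not_implyP[v0 /existsNP[i /not_implyP[iS vi]]]].
  rewrite /spcomb (big_setU1 _ njS) /= in v0.
  exists (v 0 j); split; last first.
    exists (-1 *: v); rewrite spcombZ exprN1p mulN1r.
    by apply/eqP; rewrite -subr_eq0 opprK; apply/eqP.
  apply/eqP => vj0; apply: vi; move: iS; rewrite !inE => /predU1P[->//|iS].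
  by apply: indepS iS; move: v0; rewrite vj0 expr0n gtn_eqF // mul0r add0r.
pose d := \prod_j sval (H j); exists d; split=> //.
  by apply/prodf_neq0 => j _; case: (svalP (H j)).
move=> x; have [a ->] := u_span x; rewrite /pcomb mulr_sumr.
apply: (big_ind (fun y => exists v, y = spcomb S v)) => [|_ _ [v ->] [w ->]|j _].
- by exists 0; rewrite spcomb0.
- by exists (1 *: v + w); rewrite spcombP expr1n mul1r.
- have [_ [v ev]] := svalP (H j); rewrite /d (bigD1 j) //= exprMn.
  set e := \prod_(_ | _) _; exists ((e * a j) *: v).
  by rewrite spcombZ -ev exprMn; ring.
Qed.

Local Notation qlen I := (len (I : set R^o) setT).

Lemma lle_widen (A : comNzRingType) (n : set A) (V : lmodType A) (N N' : set V) k :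
  n 0 -> submod N -> submod N' -> N `<=` N' -> lle n N setT k -> lle n N' setT k.
Proof.
move=> n0 sN sN' NN'; apply: (@lle_linear _ _ V V id) => // w; split=> // _.
by exists w => //; rewrite subrr; case: sN'.
Qed.

(** With S and c as in [exists_frobenius_basis] and r the size of S, the free
    module on S maps to R, the coefficients being raised to the p-th power,
    with cokernel killed by c ^ p, and multiplication by c ^ p maps R back to
    the free module, with cokernel killed by c. *)
Lemma frobenius_length : exists r c, c != 0 /\
  forall I k k', is_ideal I -> ilen m I k -> ilen m (frobenius_power I p) k' ->
    (qlen (frobenius_power I p) <=
      r * qlen I + qlen (idealadd (frobenius_power I p) (c ^+ p)))%N /\
    (r * qlen I <= qlen (frobenius_power I p) + r * qlen (idealadd I c))%N.
Proof.
have [S [c [c0 indepS Sspan]]] := exists_frobenius_basis.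
exists #|S|, c; split=> // I k k' iI Ik Fk.
set F := frobenius_power I p in Fk *.
have iF : is_ideal F := ideal_gen_ideal _.
have m0 : m 0 by exact: ideal0.
pose co (i : 'I_s) (v : 'rV[R]_s) : R := v 0 i.
pose e (i : 'I_s) : 'rV[R]_s := delta_mx 0 i.
have co_lin i a : {morph co i : v w / a *: v + w >-> a * v + w}.
  by move=> v w; rewrite /co !mxE.
have co_e i j : co i (e j) = (i == j)%:R by rewrite /co mxE eqxx.
(* Coordinates outside S are left free, so that they do not count. *)
pose ext (L : set R) i : set R := if i \in S then L else setT.
have iext L i : is_ideal L -> is_ideal (ext L i) by rewrite /ext; case: ifP.
pose N1 L := coord_prod co (ext L).
have prodL L l : is_ideal L -> ilen m L l ->
    lle m (N1 L) setT (#|S| * qlen L)%N /\ len (N1 L) setT = (#|S| * qlen L)%N.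
  move=> iL Ll.
  have lenT : qlen [set: R] = 0%N.
    by apply/eqP; rewrite -leqn0; apply: (@len_le _ m m_field R^o _ _ _ (submodT _) (lle0 _ _)).
  have extl i : ilen m (ext L i) (if i \in S then qlen L else 0%N).
    rewrite /ext; case: ifP => _; last exact: lle0.
    exact: (@lle_len _ m m_field R^o _ _ _ iL Ll).
  have [H1 H2] := len_prod m_field m0 co_lin co_e (fun i => iext L i iL) extl.
  have sumS (z : nat) : (\sum_(i < s) (if i \in S then z else 0) = #|S| * z)%N.
    by rewrite -big_mkcond sum_nat_const.
  rewrite sumS in H1; split=> //; rewrite /N1 H2 -sumS.
  by apply: eq_bigr => i _; rewrite /ext; case: ifP.
have sN1 L : is_ideal L -> submod (N1 L).
  move=> iL; split=> [i|a v w Nv Nw i]; first by rewrite /co mxE; apply: ideal0 (iext L i iL).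
  by rewrite co_lin; apply: (idealD (iext L i iL)) => //; apply: (idealM _ (iext L i iL)).
have [IN1 lenN1] := prodL I k iI Ik.
pose f (v : 'rV[R]_s) : restr frob := spcomb S v.
have fl a : {morph f : v w / a *: v + w} by move=> v w; rewrite /f spcombP.
have memF x : I x -> F (x ^+ p) by move=> Ix; apply: sub_ideal_gen; exists x.
have sF : submod (F : set (restr frob)) by apply: ideal_submod.
have f_local a : m a -> m (frob a).
  by move=> ma; change (m (a ^+ p)); rewrite -(prednK p_gt0) exprSr; apply: idealM.
have f_res b : exists a, m (b - frob a) := R_perfect b.
have qlenF : len (F : set (restr frob)) setT = qlen F.
  exact: (len_restr m_field m_field f_local f_res iF Fk).
split.
  have iFc : is_ideal (idealadd F (c ^+ p)) by apply: idealadd_ideal.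
  have Fck : ilen m (idealadd F (c ^+ p)) k' by apply: ilenS Fk => //; apply: sub_idealadd.
  pose M : set (restr frob) := [set w | exists2 v, [set: 'rV[R]_s] v & F (w - f v)].
  have FM : lle m (F : set (restr frob)) M (#|S| * qlen I)%N.
    apply: (lle_linear m0 fl (sN1 I iI) sF _ _ IN1) => // v Nv.
    change (F (spcomb S v)); apply: (ideal_sum _ iF) => i iS; rewrite mulrC; apply: (idealM _ iF); apply: memF.
    by have := Nv i; rewrite /ext iS.
  have sM : submod M := lle_submod sF FM.
  rewrite -qlenF; apply: (len_le m_field sF); apply: lle_trans FM _.
  apply: (@lle_widen _ _ (restr frob) (idealadd F (c ^+ p))) => //; first exact: ideal_submod.
    move=> w [b Fw]; have [v ev] := Sspan b; exists v => //.
    by rewrite /f -ev mulrC.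
  apply: (lle_restr f_local f_res iFc).
  exact: (@lle_len _ m m_field R^o _ _ _ iFc Fck).
(* Multiplication by c ^ p factors through the free module on S. *)
have lift x : {v : 'rV[R]_s | f v = c ^+ p * x /\ forall i, i \notin S -> v 0 i = 0}.
  apply: cid; have [v ev] := Sspan x.
  exists (\row_i if i \in S then v 0 i else 0); split=> [|i /negPf iS]; last by rewrite mxE iS.
  by rewrite ev /f; apply: eq_bigr => i iS; rewrite mxE iS.
have f_inj v w : f v = f w -> (forall i, i \notin S -> v 0 i = w 0 i) -> v = w.
  move=> fvw off; apply/rowP => i; have [iS|/off//] := boolP (i \in S).
  apply/eqP; rewrite -subr_eq0; apply/eqP.
  have := indepS (-1 *: w + v) _ i iS; rewrite !mxE mulN1r addrC; apply.
  by change (f (-1 *: w + v) = 0); rewrite fl fvw scaleN1r addNr.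
pose g (x : restr frob) : 'rV[R]_s := sval (lift x).
have fg x : f (g x) = c ^+ p * x by case: (svalP (lift x)).
have g_off x i : i \notin S -> (g x) 0 i = 0 by case: (svalP (lift x)) => _; apply.
have gl a : {morph g : x y / a *: x + y}.
  move=> x y; apply: f_inj => [|i iS]; last by rewrite !mxE !g_off // mulr0 addr0.
  by rewrite fl !fg !restr_scaleE mulrDr mulrCA.
have g0 : g 0 = 0 by have := gl (-1) 0 0; rewrite scaler0 addr0 scaleN1r addNr.
have gZ a (x : restr frob) : g (a *: x) = a *: g x by rewrite -[a *: x]addr0 gl g0 addr0.
have ic : is_ideal (idealadd I c) by apply: idealadd_ideal.
have ck : ilen m (idealadd I c) k by apply: ilenS Ik => //; apply: sub_idealadd.
have [cN1 _] := prodL _ k ic ck.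
pose M : set 'rV[R]_s := [set w | exists2 x, [set: restr frob] x & N1 I (w - g x)].
have FT : lle m (F : set (restr frob)) setT (qlen F).
  apply: (lle_restr f_local f_res iF).
  exact: (@lle_len _ m m_field R^o _ _ _ iF Fk).
have NM : lle m (N1 I) M (qlen F).
  apply: (lle_linear m0 gl sF (sN1 I iI) _ _ FT) => // x Fx.
  have iT : is_ideal [set x | forall a : R, N1 I (g (a * x))].
    have [N10 N1l] := sN1 I iI.
    split=> [a|a y z Ny Nz b]; first by rewrite mulr0 g0.
    have gD y' z' : g ((y' : restr frob) + z') = g y' + g z'.
      by have := gl 1 y' z'; rewrite !scale1r.
    by rewrite mulrDr mulrA (gD (b * a * y)) -[g (_ * y)]scale1r; apply: N1l.
  suff : forall a, N1 I (g (a * x)) by move/(_ 1); rewrite mul1r.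
  apply: (ideal_gen_sub iT _ Fx) => _ [y Iy <-] a i.
  have -> : g (a * y ^+ p) = y *: g a by rewrite -gZ restr_scaleE mulrC.
  rewrite /ext; case: ifP => // _; rewrite /co mxE mulrC; exact: idealM.
have sM : submod M := lle_submod (sN1 I iI) NM.
rewrite -lenN1; apply: (len_le m_field (sN1 I iI)); apply: lle_trans NM _.
apply: lle_widen cN1 => //; first exact: sN1.
move=> w Nw.
have coef i : {b : R | i \in S -> I (w 0 i - b * c)}.
  apply: cid; case: (boolP (i \in S)) => iS; last by exists 0.
  by have := Nw i; rewrite /ext iS => -[b Iw]; exists b.
pose b : 'rV[R]_s := \row_i sval (coef i).
exists (f b) => // i; rewrite /ext; case: ifP => // iS.
have -> : co i (w - g (f b)) = w 0 i - sval (coef i) * c.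
  rewrite /co !mxE; congr (_ - _).
  pose cb : 'rV[R]_s := \row_i if i \in S then c * b 0 i else 0.
  have -> : g (f b) = cb.
    apply: f_inj => [|j jS]; last by rewrite g_off // mxE (negPf jS).
    rewrite fg /f /spcomb mulr_sumr; apply: eq_bigr => j jS.
    by rewrite [cb _ _]mxE jS exprMn mulrA.
  transitivity (c * b 0 i); last by rewrite mxE mulrC.
  by clearbody b; rewrite mxE iS.
exact: (svalP (coef i)).
Qed.
End FrobeniusRank.

(** * The extension by a root of z *)

Section RootExtension.
(** B is free over f R on the powers of Y up to the n-th one, with coordinates
    co, and Y ^ (n + 1) = f z. *)
Variables (R B : comNzRingType) (f : {rmorphism R -> B}) (Y : B) (z : R) (n : nat).
Variable co : 'I_n.+1 -> B -> R.
Hypothesis Y_root : Y ^+ n.+1 = f z.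
Hypothesis co_lin : forall i a, {morph co i : u v / f a * u + v >-> a * u + v}.
Hypothesis coE : forall u, u = \sum_i f (co i u) * Y ^+ i.
Hypothesis co_Yn : forall i j : 'I_n.+1, co i (Y ^+ j) = (i == j)%:R.

Lemma co0 i : co i 0 = 0.
Proof. by have := co_lin i (-1) 0 0; rewrite mulr0 addr0 mulN1r addNr. Qed.

Lemma coZ i a u : co i (f a * u) = a * co i u.
Proof. by rewrite -[f a * u]addr0 co_lin co0 addr0. Qed.

Lemma coD i : {morph co i : u v / u + v}.
Proof. by move=> u v; rewrite -[u]mul1r -(rmorph1 f) co_lin rmorph1 !mul1r. Qed.

Lemma co_sum i T (r : seq T) (P : pred T) (F : T -> B) :
  co i (\sum_(j <- r | P j) F j) = \sum_(j <- r | P j) co i (F j).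
Proof. by apply: (big_morph (co i)); [exact: coD|exact: co0]. Qed.

Lemma co_f i a : co i (f a) = (i == ord0)%:R * a.
Proof. by rewrite -[f a]mulr1 -(expr0 Y) coZ (co_Yn i ord0) mulrC. Qed.

(** Multiplication by Y shifts the coordinates cyclically and multiplies by z the
    one that comes round. *)
Lemma mulYE u : Y * u = f (z * co ord_max u) +
  \sum_(j < n) f (co (widen_ord (leqnSn n) j) u) * Y ^+ (lift ord0 j).
Proof.
rewrite {1}[u]coE mulr_sumr big_ord_recr /= addrC; congr (_ + _).
  by rewrite mulrCA -exprS Y_root -rmorphM mulrC.
by apply: eq_bigr => j _; rewrite mulrCA -exprS.
Qed.

Lemma co_Y0 u : co ord0 (Y * u) = z * co ord_max u.
Proof.
rewrite mulYE coD co_f eqxx mul1r co_sum big1 ?addr0 // => j _.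
by rewrite coZ co_Yn mulr0.
Qed.

Lemma co_YS u (i : 'I_n) : co (lift ord0 i) (Y * u) = co (widen_ord (leqnSn n) i) u.
Proof.
rewrite mulYE coD co_f mul0r add0r co_sum (bigD1 i) // big1 => [|j /andP[_ ji]].
  by rewrite Monoid.mulm1 coZ co_Yn eqxx mulr1.
by rewrite coZ co_Yn (inj_eq lift_inj) eq_sym (negPf ji) mulr0.
Qed.

Lemma root_decomp u : exists w, u = f (co ord0 u) + Y * w.
Proof.
exists (\sum_(i < n) f (co (lift ord0 i) u) * Y ^+ i).
rewrite {1}[u]coE big_ord_recl expr0 mulr1 mulr_sumr; congr (_ + _).
by apply: eq_bigr => i _; rewrite mulrCA -exprS.
Qed.

Lemma ideal_rootP (N : set B) : N 0 -> (forall u v, N u -> N v -> N (u + v)) ->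
  (forall a u, N u -> N (f a * u)) -> (forall u, N u -> N (Y * u)) -> is_ideal N.
Proof.
move=> N0 ND NZ NY; split=> // a x y Nx Ny; apply: (ND) => //.
rewrite [a]coE mulr_suml; apply: big_ind => // i _.
rewrite -mulrA; apply: NZ; elim: (nat_of_ord i) => [|j IH]; first by rewrite mul1r.
by rewrite exprS -mulrA; apply: NY.
Qed.

Lemma root_extension_integral : integralRange f.
Proof.
have intY : integralOver f Y.
  exists ('X^(n.+1) - z%:P); first exact: monicXnsubC.
  by rewrite rmorphB /= map_polyXn map_polyC /= rootE !hornerE Y_root subrr.
move=> u; rewrite [u]coE; apply: (big_ind (integralOver f)) => [|x y|i _].
- exact: mxpoly.integral0.
- exact: integral_add.
- apply: integral_mul; first exact: integral_id.
  elim: (nat_of_ord i) => [|j IH]; first exact: mxpoly.integral1.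
  by rewrite exprS; apply: integral_mul.
Qed.

Variable m : set R.
Hypotheses (m_field : forall a, ~ m a -> exists b, m (b * a - 1)).
Hypotheses (m_ideal : is_ideal m) (mz : m z).

(** The maximal ideal generated by m and Y. *)
Definition root_max : set B := [set u | m (co ord0 u)].

Lemma root_max_ideal : is_ideal root_max.
Proof.
apply: ideal_rootP; rewrite /root_max /mkset.
- by rewrite co0; apply: ideal0.
- by move=> u v mu mv; rewrite coD; apply: idealD.
- by move=> a u mu; rewrite coZ; apply: idealM.
- by move=> u _; rewrite co_Y0 mulrC; apply: idealM.
Qed.

Lemma root_max_field u : ~ root_max u -> exists w, root_max (w * u - 1).
Proof.
move=> /m_field[b mb]; exists (f b); rewrite /root_max /mkset.
by rewrite -(rmorph1 f) -rmorphN coD coZ co_f eqxx mul1r.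
Qed.

Lemma root_max_f a : m a -> root_max (f a).
Proof. by move=> ma; rewrite /root_max /mkset co_f eqxx mul1r. Qed.

Lemma root_max_residue u : exists a, root_max (u - f a).
Proof.
exists (co ord0 u); rewrite /root_max /mkset -rmorphN coD co_f eqxx mul1r subrr.
exact: ideal0.
Qed.

(** The layers of the Y-adic filtration are quotients of R. *)
Lemma ilen_root (J : set R) (N : set B) k l : is_ideal J -> is_ideal N ->
  (forall a, J a -> N (f a)) -> N (Y ^+ l) -> ilen m J k -> ilen root_max N (l * k)%N.
Proof.
move=> iJ iN JN NYl Jk; apply: (ilen_pow root_max_ideal (x := Y)) => //.
have iNY := idealadd_ideal Y iN.
have NY w : idealadd N Y (Y * w).
  by rewrite mulrC; apply: (idealM _ iNY); apply: mem_idealadd.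
have key b v : idealadd N Y (b * f v - f (co ord0 b * v)).
  have [w {1}->] := root_decomp b.
  by rewrite rmorphM mulrDl addrC addKr mulrAC -mulrA.
have -> : [set: B^o] = imgmod f (idealadd N Y : set B^o) [set: R^o].
  apply/seteqP; split=> // u _; exists (co ord0 u) => //.
  by have := key u 1; rewrite rmorph1 !mulr1.
apply: (@lle_image R B m root_max R^o B^o f (rmorphB f) J setT (idealadd N Y)) Jk => //.
- by move=> v /JN; apply: sub_idealadd.
- by move=> b v; exists (co ord0 b); apply: key.
- by move=> b v mb; exists (co ord0 b) => //; apply: key.
- move=> a v; exists (f a), 0; split; first exact: ideal0.
  have <- : 0 = f (a *: v) - f a *: (f v : B^o) - f (0 *: v).
    by rewrite -[f a *: (f v : B^o)]/(f a * f v) -rmorphM subrr scale0r rmorph0 subr0.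
  exact: ideal0.
Qed.

Variables (p e a : nat) (J : set R).
Hypothesis B_char : p \in [pchar B].
Let q := (p ^ e)%N.
Let c := (a * q %/ n.+1)%N.
Let rho := (a * q %% n.+1)%N.

Let frobD (x y : B) : (x + y) ^+ q = x ^+ q + y ^+ q.
Proof.
have prime_p : prime p by move: B_char; rewrite inE => /andP[].
by rewrite exprDn_pchar // /q pnatX pnatE // B_char.
Qed.

Let rho_le : (rho <= n)%N. Proof. by rewrite -ltnS ltn_mod. Qed.

Let F := frobenius_power J q.
Let iF : is_ideal F := ideal_gen_ideal _.

Lemma idealadd_exp (I : set R) i j : is_ideal I -> (i <= j)%N ->
  idealadd I (z ^+ j) `<=` idealadd I (z ^+ i).
Proof.
move=> iI le_ij; apply: idealadd_sub; [exact: idealadd_ideal|exact: sub_idealadd|].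
by rewrite -(subnK le_ij) exprD; apply: (idealM _ (idealadd_ideal _ iI)); apply: mem_idealadd.
Qed.

Let part (i : 'I_n.+1) : set R := idealadd F (z ^+ (c + (i < rho))).
Let ipart i : is_ideal (part i) := idealadd_ideal _ iF.
Let N : set B := [set u | forall i, part i (co i u)].

Let N_ideal : is_ideal N.
Proof.
apply: ideal_rootP; rewrite /N /mkset.
- by move=> i; rewrite co0; apply: ideal0 (ipart i).
- by move=> u v Nu Nv i; rewrite coD; apply: (idealD (ipart i)).
- by move=> r u Nu i; rewrite coZ; apply: (idealM _ (ipart i)).
- move=> u Nu i; case: (unliftP ord0 i) => [j|] ->; last first.
    rewrite co_Y0; have [r Fr] := Nu ord_max.
    rewrite -[co _ _](subrK (r * z ^+ c)) mulrDr; apply: (idealD (ipart _)).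
      apply: sub_idealadd; apply: (idealM _ iF); move: Fr.
      by rewrite ltnNge rho_le addn0.
    apply: (@idealadd_exp F _ c.+1 iF); first by case: (_ < rho)%N; rewrite ?addn1 ?addn0 ?leqnSn.
    rewrite mulrCA -exprS; apply: (idealM _ (idealadd_ideal _ iF)); exact: mem_idealadd.
  rewrite co_YS; apply: (idealadd_exp iF) (Nu _); rewrite leq_add2l /= /bump /=.
  by rewrite add1n; case: ltnP => // /ltnW ->.
Qed.

Let G : set B := f @` J `|` [set Y ^+ a].

(** The multiples of Y ^ (a q) = z ^ c Y ^ rho have coordinates divisible by
    z ^ c; those before the coordinate rho have come round once more, which
    brings a further factor z. *)
Lemma frobenius_root : frobenius_power (ideal_gen G) q = N.
Proof.
have Yaq : Y ^+ (a * q) = f (z ^+ c) * Y ^+ rho.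
  by rewrite (divn_eq (a * q) n.+1) exprD [(_ * n.+1)%N]mulnC exprM Y_root rmorphXn.
apply/seteqP; split.
  apply: ideal_gen_sub => // _ [x Gx <-]; move: x Gx.
  have iX : is_ideal [set x | N (x ^+ q)].
    split; rewrite /mkset; first by rewrite expr0n; case: eqP => [/eqP|_];
      [rewrite expn_eq0 => /andP[/eqP p0]; move: B_char; rewrite p0 inE|exact: ideal0 N_ideal].
    by move=> r x y Nx Ny; rewrite frobD exprMn; apply: (idealD N_ideal) => //; apply: (idealM _ N_ideal).
  apply: (ideal_gen_sub iX) => x [[j Jj <-]|->] i; rewrite /mkset.
    rewrite -rmorphXn co_f; apply: (idealM _ (ipart i)); apply: sub_idealadd.
    by apply: sub_ideal_gen; exists j.
  rewrite -exprM Yaq coZ -[rho]/(nat_of_ord (Ordinal (rho_le : (rho < n.+1)%N))) co_Yn.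
  case: eqP => [->|_]; last by rewrite mulr0; apply: ideal0 (ipart i).
  by rewrite mulr1 /part /= ltnn addn0; apply: mem_idealadd.
move=> u Nu; rewrite [u]coE; set I := frobenius_power _ q.
have iI : is_ideal I := ideal_gen_ideal _.
have memI x : G x -> I (x ^+ q).
  by move=> Gx; apply: sub_ideal_gen; exists x => //; apply: sub_ideal_gen.
apply: (ideal_sum _ iI) => i _; have [r Fr] := Nu i.
rewrite -[co i u](subrK (r * z ^+ (c + (i < rho)))) rmorphD mulrDl; apply: (idealD iI).
  rewrite mulrC; apply: (idealM _ iI); move: Fr; rewrite -[_ *: _]/(r * _).
  have iS : is_ideal [set s | I (f s)].
    split; rewrite /mkset; first by rewrite rmorph0; apply: ideal0 iI.
    by move=> s x y Ix Iy; rewrite rmorphD rmorphM; apply: (idealD iI) => //; apply: (idealM _ iI).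
  apply: (ideal_gen_sub iS) => _ [j Jj <-]; rewrite /mkset rmorphXn; apply: memI.
  by left; exists j.
rewrite rmorphM -mulrA; apply: (idealM _ iI).
have le_aq : (a * q <= n.+1 * (c + (i < rho)) + i)%N.
  rewrite (divn_eq (a * q) n.+1) -/c -/rho mulnDr mulnC -addnA leq_add2l.
  case: ltnP => [lt_i|le_i]; last by rewrite muln0.
  by rewrite muln1 (leq_trans rho_le) // (leq_trans (leqnSn n)) // leq_addr.
rewrite rmorphXn -Y_root -exprM -exprD -(subnK le_aq) exprD exprM.
apply: (idealM _ iI); apply: memI; by right.
Qed.

Lemma quotient_length_root k : ilen m F k ->
  quotient_length (frobenius_power (ideal_gen G) q) =
    ((n.+1 - rho) * quotient_length (idealadd F (z ^+ c)) +
     rho * quotient_length (idealadd F (z ^+ c.+1)))%N.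
Proof.
move=> Fk; have iG : is_ideal (frobenius_power (ideal_gen G) q) := ideal_gen_ideal _.
have Gk : ilen root_max (frobenius_power (ideal_gen G) q) (a * q * k)%N.
  have memG x : G x -> frobenius_power (ideal_gen G) q (x ^+ q).
    by move=> Gx; apply: sub_ideal_gen; exists x => //; apply: sub_ideal_gen.
  apply: (ilen_root iF iG) Fk; last by rewrite exprM; apply: memG; right.
  have iS : is_ideal [set s | frobenius_power (ideal_gen G) q (f s)].
    split; rewrite /mkset; first by rewrite rmorph0; apply: ideal0 iG.
    by move=> s x y Ix Iy; rewrite rmorphD rmorphM; apply: (idealD iG) => //; apply: (idealM _ iG).
  by apply: (ideal_gen_sub iS) => _ [j Jj <-]; rewrite /mkset rmorphXn; apply: memG; left; exists j.
have m0 : m 0 by exact: ideal0.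
rewrite !quotient_lengthE.
rewrite -(len_restr m_field root_max_field root_max_f root_max_residue iG Gk).
have partk i : ilen m (part i) k by apply: ilenS Fk => //; apply: sub_idealadd.
have co_lin' i r : {morph (co i : restr f -> R) : u v / r *: u + v >-> r * u + v}.
  exact: co_lin.
have [_ lenN] := @len_prod R m m_field m0 (restr f) n.+1 (fun i => Y ^+ i) co co_lin' co_Yn part _ ipart partk.
rewrite frobenius_root; apply: (etrans lenN).
pose L i := len (idealadd F (z ^+ (c + i)) : set R^o) setT.
rewrite (eq_bigr (fun i : 'I_n.+1 => L (nat_of_bool (i < rho)%N))) //.
rewrite (bigID (fun i : 'I_n.+1 => (i < rho)%N)) /= [RHS]addnC.
rewrite (eq_bigr (fun=> L 1%N)) => [|i ->//].
rewrite [X in (_ + X)%N = _](eq_bigr (fun=> L 0%N)) => [|i /negPf ->//].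
rewrite !sum_nat_const /L addn0 addn1.
have card_lt : #|[pred i : 'I_n.+1 | (i < rho)%N]| = rho.
  by rewrite -sum1_card -(big_ord_widen n.+1 (fun=> 1%N)) ?sum1_card ?card_ord // (leq_trans rho_le).
congr (_ * _ + _ * _)%N => //.
have := cardC [pred i : 'I_n.+1 | (i < rho)%N]; rewrite card_lt card_ord => cardE.
by apply: (@addnI rho); rewrite subnKC; [exact: cardE|exact: leqW rho_le].
Qed.

End RootExtension.

(** * Dimension of an integral extension *)

Section IntegralExtension.
Variables (R B : comNzRingType) (f : {rmorphism R -> B}).
Hypothesis f_inj : forall a, f a = 0 -> a = 0.
Hypothesis f_int : integralRange f.

Lemma preimage_prime (Q : set B) : is_prime_ideal Q -> is_prime_ideal (f @^-1` Q).
Proof.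
move=> [iQ Q1 Qp]; split=> [||x y]; rewrite /preimage /mkset.
- split; rewrite /mkset; first by rewrite rmorph0; apply: ideal0.
  move=> a x y Qx Qy; rewrite rmorphD rmorphM.
  by apply: idealD => //; apply: idealM.
- by rewrite rmorph1.
- by rewrite rmorphM; apply: Qp.
Qed.

(** A polynomial of least degree among the monic ones that take u to Q has its
    constant coefficient in Q' but not in Q. *)
Lemma preimage_proper (Q Q' : set B) : is_prime_ideal Q -> is_ideal Q' ->
  Q `<` Q' -> f @^-1` Q `<` f @^-1` Q'.
Proof.
move=> [iQ Q1 Qp] iQ' [QQ' /existsNP[u /not_implyP[Q'u nQu]]].
split; first by move=> a /QQ'.
have exn : exists n, `[< exists q : {poly R}, [/\ q \is monic, size q = n &
    Q (map_poly f q).[u]] >].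
  have [q mq /rootP qu0] := f_int u; exists (size q); apply/asboolP; exists q; split=> //.
  by rewrite qu0; apply: ideal0.
case: (ex_minnP exn) => n /asboolP[q [mq sq Qq]] minn.
have [q1 [c eq]] : exists q1 (c : R), q = q1 * 'X + c%:P.
  by elim/poly_ind: (q) => [|q1 c _]; [exists 0, 0; rewrite mul0r add0r|exists q1, c].
have qu : (map_poly f q).[u] = (map_poly f q1).[u] * u + f c.
  by rewrite eq rmorphD rmorphM /= map_polyX map_polyC hornerMXaddC.
have [q10|q1n0] := eqVneq q1 0.
  move: mq Qq; rewrite qu eq q10 !mul0r rmorph0 horner0 mul0r !add0r => /monicP.
  by rewrite lead_coefC => ->; rewrite rmorph1.
have size_q : size q = (size q1).+1.
  by rewrite eq size_MXaddC (negPf q1n0).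
have mq1 : q1 \is monic.
  move/monicP: mq => /= lq; apply/monicP; rewrite -lq eq lead_coefDl ?lead_coefMX //.
  by rewrite size_polyC size_mulX // ltnS; case: (c != 0); rewrite // lt0n size_poly_eq0.
move/(_ c); rewrite /preimage /mkset => H.
have Q'c : Q' (f c).
  have := QQ' _ Qq; rewrite qu => Q'q.
  have -> : f c = ((map_poly f q1).[u] * u + f c) - (map_poly f q1).[u] * u by ring.
  by apply: idealB => //; apply: idealM.
have /Qp[Qq1|//] : Q ((map_poly f q1).[u] * u).
  have -> : (map_poly f q1).[u] * u = (map_poly f q).[u] - f c by rewrite qu addrK.
  by apply: idealB => //; apply: H.
suff : (size q <= size q1)%N by rewrite size_q ltnn.
by rewrite sq; apply: minn; apply/asboolP; exists q1.
Qed.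

Lemma ideal_subX (Q : set B) x y i : is_ideal Q -> Q (x - y) -> Q (x ^+ i - y ^+ i).
Proof. by move=> iQ Qxy; rewrite subrXX mulrC; apply: idealM. Qed.

(** Take Q maximal among the ideals above Q0 whose preimage is in P. If some f a
    with a in P were outside Q, then f s = w f a modulo Q for some w and some s
    outside P; multiplying an integral equation of degree d for w by f a ^ d
    would give s ^ d in P. *)
Lemma going_up (Q0 : set B) (P : set R) : is_ideal Q0 -> is_prime_ideal P ->
  f @^-1` Q0 `<=` P -> exists Q, [/\ is_prime_ideal Q, Q0 `<=` Q & f @^-1` Q = P].
Proof.
move=> iQ0 [iP P1 Pp] Q0P.
(* The union with Q0 makes the empty chain admissible in Zorn's lemma. *)
pose good X := is_ideal (Q0 `|` X) /\ f @^-1` (Q0 `|` X) `<=` P.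
have [F Fgood totF|A [[iA AP] maxA]] := @Zorn_bigcup B good.
  have step x y : (Q0 `|` \bigcup_(X in F) X) x -> (Q0 `|` \bigcup_(X in F) X) y ->
      exists X, [/\ (X = set0 \/ F X), (Q0 `|` X) x & (Q0 `|` X) y].
    move=> [Qx|[X FX Xx]] [Qy|[Z FZ Zy]].
    - by exists set0; split; left.
    - by exists Z; split; [right|left|right].
    - by exists X; split; [right|right|left].
    - have [XZ|ZX] := totF X Z FX FZ.
        by exists Z; split; [right|right; apply: XZ|right].
      by exists X; split; [right|right|right; apply: ZX].
  have goodX X : X = set0 \/ F X -> good X.
    by move=> [->|/Fgood//]; rewrite /good setU0.
  have subU X : X = set0 \/ F X -> Q0 `|` X `<=` Q0 `|` \bigcup_(X in F) X.
    by move=> [->|FX] x [Qx|Xx]; [left|case: Xx|left|right; exists X].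
  split.
    split; first by left; apply: ideal0.
    move=> a x y Ux Uy; have [X [FX Xx Xy]] := step x y Ux Uy.
    have [iX _] := goodX X FX; apply: (subU X FX).
    by apply: idealD => //; apply: idealM.
  move=> a Ua; have [X [FX Xx _]] := step _ _ Ua Ua.
  by have [_] := goodX X FX; apply.
pose Q := Q0 `|` A; rewrite -/Q in iA AP.
have bigger x : ~ Q x -> exists s, ~ P s /\ idealadd Q x (f s).
  move=> nQx; apply: contrapT => nos; apply: (maxA (idealadd Q x)).
    split; first by move=> y Ay; apply: sub_idealadd; right.
    by move=> s; apply: nQx; right; apply: s; apply: mem_idealadd.
  have eQ : Q0 `|` idealadd Q x = idealadd Q x.
    by apply/seteqP; split=> y; [case=> // Qy; apply: sub_idealadd; left|right].
  rewrite /good eQ; split; first exact: idealadd_ideal.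
  by move=> s Qs; apply: contrapT => nPs; apply: nos; exists s.
have Qprime : is_prime_ideal Q.
  split=> // [Q1|x y Qxy]; first by apply/P1/AP; rewrite /preimage /mkset rmorph1.
  apply: contrapT => /not_orP[/bigger[s [nPs [b Qb]]] /bigger[t [nPt [c Qc]]]].
  suff [] : P s \/ P t by [].
  apply: Pp; apply: AP; rewrite /preimage /mkset rmorphM.
  have -> : f s * f t = f t * (f s - b * x) + (b * x) * (f t - c * y) + (b * c) * (x * y) by ring.
  by do 2?apply: idealD => //; apply: idealM.
exists Q; split=> //; first by move=> x; left.
apply/seteqP; split=> // a Pa; apply: contrapT => /bigger[s [nPs [w Qw]]].
have Pexp k : P (s ^+ k) -> P s.
  by elim: k => [/P1//|k IH]; rewrite exprS => /Pp[].
have [q mq /rootP qw0] := f_int w.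
have sq : size q = (size q).-1.+1 by rewrite prednK // lt0n size_poly_eq0 monic_neq0.
set d := (size q).-1 in sq.
have qd : q`_d = 1 by move/monicP: mq; rewrite lead_coefE.
apply: nPs; apply: (Pexp d).
have : P (\sum_(i < d.+1) q`_i * a ^+ (d - i) * s ^+ i).
  apply: AP; rewrite /preimage /mkset rmorph_sum /=.
  have -> : \sum_(i < d.+1) f (q`_i * a ^+ (d - i) * s ^+ i) =
      \sum_(i < d.+1) f (q`_i * a ^+ (d - i)) * (f s ^+ i - (w * f a) ^+ i).
    have E : \sum_(i < d.+1) f (q`_i * a ^+ (d - i)) * (w * f a) ^+ i = 0.
      transitivity (f a ^+ d * (map_poly f q).[w]); last by rewrite qw0 mulr0.
      rewrite (@horner_coef_wide _ d.+1); last by rewrite -sq; apply: size_poly.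
      rewrite mulr_sumr; apply: eq_bigr => i _; rewrite coef_map rmorphM rmorphXn /=.
      have -> : f a ^+ d = f a ^+ (d - i) * f a ^+ i by rewrite -exprD subnK // -ltnS.
      by rewrite exprMn; ring.
    under [RHS]eq_bigr => i _ do rewrite mulrBr.
    rewrite sumrB E subr0; apply: eq_bigr => i _.
    by rewrite rmorphM (rmorphXn f i s).
  apply: ideal_sum => // i _; apply: idealM => //; exact: ideal_subX.
rewrite big_ord_recr /= qd subnn expr0 !mul1r => Psum.
rewrite -[s ^+ d](addKr (\sum_(i < d) q`_i * a ^+ (d - i) * s ^+ i)) addrC.
apply: idealB => //; apply: ideal_sum => // i _.
rewrite mulrAC -(prednK (_ : 0 < d - i)%N) ?subn_gt0 // exprSr mulrA; exact: idealM.
Qed.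

Lemma krull_dim_integral : krull_dim B = krull_dim R.
Proof.
rewrite /krull_dim; congr supremum; apply/seteqP; split=> n [P [pP PS]].
  exists (fun i => f @^-1` P i); split=> i lei; first exact/preimage_prime/pP.
  apply: preimage_proper (PS i lei); first exact: pP (ltnW lei).
  by have [] := pP i.+1 lei.
suff [Q [pQ QP QS]] : exists Q : nat -> set B,
    [/\ forall i, (i <= n)%N -> is_prime_ideal (Q i),
        forall i, (i <= n)%N -> f @^-1` Q i = P i &
        forall i, (i < n)%N -> Q i `<` Q i.+1] by exists Q.
elim: n pP PS => [|n IH] pP PS.
  have i0 : is_ideal [set 0 : B].
    by split=> // a x y -> ->; rewrite /mkset mulr0 addr0.
  have [a /f_inj ->|Q [pQ _ QP]] := going_up i0 (pP 0%N isT).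
    by have [iP _ _] := pP 0%N isT; apply: ideal0.
  by exists (fun=> Q); split=> // i; rewrite leqn0 => /eqP->.
have [i lei|i lti|Q [pQ QP QS]] := IH; first exact/pP/leqW.
  exact/PS/leqW.
have iQn : is_ideal (Q n) by have [] := pQ n (leqnn n).
have [PnS nPnS] := PS n (ltnSn n).
have [|Qn [pQn QQn QnP]] := going_up iQn (pP n.+1 (leqnn _)).
  by rewrite QP.
exists (fun i => if (i <= n)%N then Q i else Qn); split=> i.
- by rewrite leq_eqVlt ltnS; case: leqP => [/pQ//|_ _].
- by rewrite leq_eqVlt ltnS; case: leqP => [/QP//|_]; rewrite orbF => /eqP ->.
- rewrite ltnS => le_in; rewrite le_in; case: (ltnP i n) => [/QS//|le_ni].
  have -> : i = n by apply/eqP; rewrite eqn_leq le_in.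
  split=> // QnQ; apply: nPnS; rewrite -QnP -(QP n) //.
  by move=> a; apply: QnQ.
Qed.

End IntegralExtension.

(** * The ring R[Y] / (Y ^ n - z) *)

Import Pdiv.CommonRing Pdiv.RingMonic.

Section RootRing.
Variables (R : comNzRingType) (z : R) (n : nat).
Local Notation h := (root_poly z n.+1).
Local Notation B := {poly %/ h}.

Lemma root_poly_monic : h \is monic.
Proof. by rewrite /root_poly monicXnsubC. Qed.

Lemma mk_monic_root : mk_monic h = h.
Proof. by rewrite /mk_monic root_poly_monic andbT /root_poly size_XnsubC. Qed.

Lemma size_mk_root : size (mk_monic h) = n.+2.
Proof. by rewrite mk_monic_root /root_poly size_XnsubC. Qed.

Definition root_co (i : 'I_n.+1) (u : B) : R := (u : {poly R})`_i.

Lemma qX_exp j : ('qX : B) ^+ j = in_qpoly h 'X^j.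
Proof. by rewrite rmorphXn. Qed.

Lemma qpolyC_in c : qpolyC h c = in_qpoly h c%:P.
Proof.
apply: val_inj; rewrite /= rmodp_small // size_mk_root size_polyC.
by case: (c != 0).
Qed.

Lemma qX_root : ('qX : B) ^+ n.+1 = qpolyC h z.
Proof.
rewrite qX_exp qpolyC_in; apply/eqP; rewrite -subr_eq0 -rmorphB; apply/eqP.
apply: val_inj => /=; rewrite mk_monic_root -/(root_poly z n.+1).
by rewrite rmodpp ?root_poly_monic.
Qed.

Lemma root_co_linear i a :
  {morph root_co i : u v / qpolyC h a * u + v >-> a * u + v}.
Proof.
move=> u v; rewrite /root_co /= coefD; congr (_ + _).
rewrite rmodp_small ?mul_polyC ?coefZ //.
exact: leq_ltn_trans (size_scale_leq _ _) (size_mk_monic _).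
Qed.

Lemma root_co_qX i (j : 'I_n.+1) : root_co i ('qX ^+ j) = (i == j)%:R.
Proof.
rewrite qX_exp /root_co /= rmodp_small ?coefXn //.
by rewrite size_polyXn size_mk_root !ltnS leq_ord.
Qed.

Lemma root_coE u : u = \sum_(i < n.+1) qpolyC h (root_co i u) * 'qX ^+ i.
Proof.
transitivity (in_qpoly h u).
  by apply: val_inj; rewrite /= rmodp_small // size_mk_monic.
have {1}-> : (u : {poly R}) = \sum_(i < n.+1) (root_co i u)%:P * 'X^i.
  rewrite -[LHS]coefK (@poly_def _ (size (u : {poly R}))).
  have le_un : (size (u : {poly R}) <= n.+1)%N.
    by rewrite -ltnS -size_mk_root size_mk_monic.
  rewrite (big_ord_widen _ (fun i => (u : {poly R})`_i *: 'X^i) le_un) big_mkcond.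
  apply: eq_bigr => i _; rewrite mul_polyC /root_co; case: ltnP => // le_ui.
  by rewrite nth_default // scale0r.
by rewrite rmorph_sum; apply: eq_bigr => i _; rewrite rmorphM /= qX_exp qpolyC_in.
Qed.

Lemma qpolyC_inj a : qpolyC h a = 0 -> a = 0.
Proof. by move=> /(congr1 val) /= /eqP; rewrite polyC_eq0 => /eqP. Qed.

Lemma root_integral : integralRange (qpolyC h).
Proof. exact: root_extension_integral qX_root root_coE. Qed.

Lemma krull_dim_root : krull_dim B = krull_dim R.
Proof. exact: krull_dim_integral qpolyC_inj root_integral. Qed.

Lemma quotient_length_root_ideal (m J : set R) p e a k :
  (forall x, ~ m x -> exists y, m (y * x - 1)) -> is_ideal m -> m z ->
  p \in [pchar R] -> ilen m (frobenius_power J (p ^ e)) k ->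
  quotient_length (frobenius_power (root_ideal J z a n.+1) (p ^ e)) =
   ((n.+1 - a * p ^ e %% n.+1) *
      quotient_length (idealadd (frobenius_power J (p ^ e)) (z ^+ (a * p ^ e %/ n.+1))) +
    a * p ^ e %% n.+1 *
      quotient_length (idealadd (frobenius_power J (p ^ e)) (z ^+ (a * p ^ e %/ n.+1).+1)))%N.
Proof.
move=> m_field im mz charR Jk; rewrite -(pchar_qpoly h) in charR.
exact: (quotient_length_root qX_root root_co_linear root_coE root_co_qX m_field im mz a charR Jk).
Qed.

End RootRing.

(** * The length function of J and z *)

Definition root_length (R : comNzRingType) (p : nat) (J : set R) (z : R) (e n : nat) : nat :=
  quotient_length (idealadd (frobenius_power J (p ^ e)) (z ^+ n)).

Section LengthFunction.
Variables (R : idomainType) (m : set R) (kappa : closedFieldType).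
Variables (pi : {rmorphism R -> kappa}) (p : nat).
Hypotheses (R_noeth : noetherian R) (R_local : is_local m).
Hypotheses (R_residue : residue_map m pi) (R_complete : complete_for m).
Hypothesis R_char : p \in [pchar R].
Variables (z : R) (J : set R).
Hypotheses (z0 : z != 0) (mz : m z).
Hypotheses (J_ideal : is_ideal J) (J_nil : forall x, m x -> exists n, J (x ^+ n)).

Let m_ideal : is_ideal m := local_ideal R_local.
Let m_field := local_field R_noeth R_local.
Let L := root_length p J z.
Let d := krull_dim R.
Let Jq e := frobenius_power J (p ^ e).
Let iJq e : is_ideal (Jq e) := ideal_gen_ideal _.
Let Jz e n := idealadd (Jq e) (z ^+ n).
Let iJz e n : is_ideal (Jz e n) := idealadd_ideal _ (iJq e).
Let qlen I := len (I : set R^o) setT.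

Let zero_ideal : is_ideal [set 0 : R].
Proof. by split=> // a x y -> ->; rewrite /mkset mulr0 addr0. Qed.

Let zero_prime : is_prime_ideal [set 0 : R].
Proof.
split; [exact: zero_ideal|exact/eqP/oner_neq0|].
by move=> x y /eqP; rewrite mulf_eq0 => /orP[] /eqP; [left|right].
Qed.

Lemma krull_dim_gt0 : (0 < krull_dim R)%N.
Proof.
rewrite lt0n; apply/eqP => d0; have [_] := krull_dim_max R_noeth R_local.
rewrite d0; apply; apply: (@prime_chain_cons _ _ m) => //.
  split; first by move=> _ ->; apply: ideal0.
  by move=> /(_ _ mz)/eqP; rewrite (negPf z0).
by exists (fun=> m); split=> // i _; apply: local_prime R_local.
Qed.

Lemma growth_ring : exists C, forall e, ilen m (Jq e) (C * (p ^ e) ^ d)%N.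
Proof.
have [_ nochain] := krull_dim_max R_noeth R_local.
have [C HC] := length_growth R_noeth R_local J_ideal J_nil zero_ideal nochain.
exists C => e; apply: (ilenS m_ideal (idealsum_ideal zero_ideal (iJq e)) (iJq e) _ (HC (p ^ e)%N)).
by apply: idealsum_sub => // _ ->; apply: ideal0.
Qed.

(** A chain of primes that contain c can be prolonged by 0. *)
Lemma growth_hypersurface c : c != 0 -> exists C, forall e,
  ilen m (idealadd (Jq e) c) (C * (p ^ e) ^ d.-1)%N.
Proof.
move=> c0; pose I := idealadd [set 0 : R] c.
have iI : is_ideal I := idealadd_ideal c zero_ideal.
have nochain : ~ prime_chain I d.-1.+1.
  rewrite prednK ?krull_dim_gt0 // => ch.
  have [_] := krull_dim_max R_noeth R_local; apply; apply: prime_chain_cons ch => //.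
  split; first exact: sub_idealadd.
  by move=> /(_ _ (mem_idealadd c zero_ideal))/eqP; rewrite (negPf c0).
have [C HC] := length_growth R_noeth R_local J_ideal J_nil iI nochain.
exists C => e; have iA := idealadd_ideal c (iJq e).
apply: (ilenS m_ideal (idealsum_ideal iI (iJq e)) iA _ (HC (p ^ e)%N)).
apply: idealsum_sub => //; last exact: sub_idealadd.
apply: idealadd_sub => //; first by move=> _ ->; apply: ideal0.
exact: mem_idealadd.
Qed.

Let finJq e : exists k, ilen m (Jq e) k.
Proof. by have [C HC] := growth_ring; exists (C * (p ^ e) ^ d)%N; apply: HC. Qed.

Let finS e I : is_ideal I -> Jq e `<=` I -> exists k, ilen m I k.
Proof. by move=> iI JI; have [k Jk] := finJq e; exists k; exact: (ilenS m_ideal (iJq e) iI JI Jk). Qed.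

Let finJz e n : exists k, ilen m (Jz e n) k.
Proof. by apply: (finS (iJz e n)); apply: sub_idealadd. Qed.

Let LE e n : L e n = qlen (Jz e n). Proof. exact: quotient_lengthE. Qed.

Let qlen_le I k : is_ideal I -> ilen m I k -> (qlen I <= k)%N.
Proof. by move=> iI Ik; apply: (len_ideal_le R_noeth R_local iI Ik). Qed.

Lemma root_length0 e : L e 0 = 0%N.
Proof.
apply/eqP; rewrite -leqn0 LE; apply: qlen_le => //; apply: ilen0 => //.
by rewrite -(expr0 z); apply: mem_idealadd.
Qed.

Let Jz_S e n : Jz e n.+1 `<=` Jz e n.
Proof. by apply: idealadd_exp. Qed.

Lemma root_length_mono e n : (L e n <= L e n.+1)%N.
Proof.
have [k Jk] := finJz e n.+1; rewrite !LE.
exact: (len_antimono R_noeth R_local (iJz _ _) (iJz _ _) (@Jz_S e n) Jk).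
Qed.

Let Jz_step e n : idealadd (Jz e n.+1) (z ^+ n) = Jz e n.
Proof.
apply/seteqP; split.
  apply: idealadd_sub => //; exact: mem_idealadd.
apply: idealadd_sub; first exact: idealadd_ideal.
  by move=> x Jx; do 2?apply: sub_idealadd.
exact: mem_idealadd.
Qed.

Let L_step e n : L e n.+1 = (len (Jz e n.+1 : set R^o) (Jz e n) + L e n)%N.
Proof.
have [k Jk] := finJz e n.+1.
by rewrite !LE /qlen (len_split R_noeth R_local (z ^+ n) (iJz _ _) Jk) Jz_step.
Qed.

(** Multiplication by z maps the n-th layer of the z-adic filtration onto the
    next one. *)
Lemma root_length_concave e n : (L e n.+2 + L e n <= L e n.+1 + L e n.+1)%N.
Proof.
suff le_layers : (len (Jz e n.+2 : set R^o) (Jz e n.+1) <= len (Jz e n.+1 : set R^o) (Jz e n))%N.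
  move: le_layers (L_step e n.+1) (L_step e n).
  by move=> le_layers -> LnE; rewrite addnAC leq_add2r LnE leq_add2r.
have [k Jk] := finJz e n.+1.
have colonk : exists l, lle m (Jz e n.+1 : set R^o) (Jz e n) l.
  exists k; rewrite -(Jz_step e n).
  apply: (lle_idealadd m_ideal (iJz _ _) (colon_ideal _ (iJz _ _)) (fun y Cy => Cy)).
  by apply: ilenS Jk => //; [exact: colon_ideal|exact: sub_colon].
have [l Jl] := colonk.
have {}Jl := @lle_len _ m m_field R^o _ _ _ (iJz e n.+1) Jl.
apply: (@len_le _ m m_field R^o _ _ _ (iJz e n.+2)).
apply: (@lle_linear _ _ R^o R^o (fun y => z * y)) Jl => //.
- exact: ideal0.
- by move=> a u v; rewrite mulrDr -[a *: u]/(a * u) mulrCA.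
- exact: iJz.
- exact: iJz.
- move=> v [r Jv]; rewrite -[v](subrK (r * z ^+ n.+1)) mulrDr.
  apply: (idealD (iJz _ _)); first by apply: sub_idealadd; apply: (idealM _ (iJq e)).
  by rewrite mulrCA -exprS; apply: (idealM _ (iJz _ _)); apply: mem_idealadd.
- move=> w; split=> [[r Jw]|[v [r Jv] Jw]].
    exists (r * z ^+ n); first by apply: (idealM _ (iJz _ _)); apply: mem_idealadd.
    by apply: sub_idealadd; rewrite mulrCA -exprS.
  have -> : w = (w - z * v) + (z * (v - r * z ^+ n) + r * z ^+ n.+1).
    by rewrite exprS; ring.
  apply: (idealD (iJz _ _)); first exact: Jz_S Jw.
  apply: (idealD (iJz _ _)); first by apply: sub_idealadd; apply: (idealM _ (iJq e)).
  by apply: (idealM _ (iJz _ _)); apply: mem_idealadd.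
Qed.

Lemma root_length_bound : exists C, forall e n, (L e n <= C * (p ^ e) ^ d)%N.
Proof.
have [C HC] := growth_ring; exists C => e n; rewrite LE; apply: qlen_le => //.
by apply: ilenS (HC e) => //; apply: sub_idealadd.
Qed.

Lemma root_length1_bound : exists C, forall e, (L e 1 <= C * (p ^ e) ^ d.-1)%N.
Proof.
have [C HC] := growth_hypersurface z0; exists C => e; rewrite LE; apply: qlen_le => //.
by rewrite /Jz expr1.
Qed.

Lemma frobenius_power_Jz e n : frobenius_power (Jz e n) p = Jz e.+1 (n * p).
Proof.
have iF : is_ideal (frobenius_power (Jz e n) p) := ideal_gen_ideal _.
have memF x : Jz e n x -> frobenius_power (Jz e n) p (x ^+ p).
  by move=> Jx; apply: sub_ideal_gen; exists x.
have p_gt0 : (0 < p)%N by move: R_char; rewrite inE => /andP[/prime_gt0].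
apply/seteqP; split.
  apply: ideal_gen_sub => // _ [x Jx <-]; move: x Jx.
  have iX : is_ideal [set x | Jz e.+1 (n * p) (x ^+ p)].
    split; rewrite /mkset; first by rewrite expr0n gtn_eqF //; apply: ideal0 (iJz _ _).
    move=> r x y Jx Jy; rewrite (exprpD R_char) exprMn.
    by apply: (idealD (iJz _ _)) => //; apply: (idealM _ (iJz _ _)).
  apply: idealadd_sub => //; last by rewrite /mkset -exprM; apply: mem_idealadd.
  apply: ideal_gen_sub => // _ [x Jx <-]; rewrite /mkset -exprM -expnSr.
  by apply: sub_idealadd; apply: sub_ideal_gen; exists x.
apply: idealadd_sub => //; last by rewrite exprM; apply: memF; apply: mem_idealadd.
apply: ideal_gen_sub => // _ [x Jx <-]; rewrite expnSr exprM; apply: memF.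
by apply: sub_idealadd; apply: sub_ideal_gen; exists x.
Qed.

(** The comparison of R with a free module over its p-th powers, applied to
    J^[q] + (z ^ n); its error terms are lengths modulo c and c ^ p, which
    [growth_hypersurface] bounds. *)
Lemma root_length_frobenius : exists r C, forall e n,
  (L e.+1 (n * p) <= r * L e n + C * (p ^ e) ^ d.-1)%N /\
  (r * L e n <= L e.+1 (n * p) + C * (p ^ e) ^ d.-1)%N.
Proof.
have R_perfect := residue_perfect R_residue R_char.
have [u u_span] := frobenius_finite R_noeth R_local R_residue R_complete R_char.
have [r [c [c0 H]]] := frobenius_length R_noeth R_local R_char R_perfect u_span.
have [C HC] := growth_hypersurface c0.
exists r, ((p * (C * p ^ d.-1)) + r * C)%N => e n.
have [k Jk] := finJz e n; have [k' Jk'] := finJz e.+1 (n * p).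
rewrite !LE -frobenius_power_Jz in Jk' *.
have iF : is_ideal (frobenius_power (Jz e n) p) := ideal_gen_ideal _.
have [H1 H2] := H _ _ _ (iJz e n) Jk Jk'; rewrite mulnDl; split.
  apply: leq_trans H1 _; rewrite leq_add2l.
  apply: leq_trans (leq_addr _ _).
  have -> : (p * (C * p ^ d.-1) * (p ^ e) ^ d.-1 = p * (C * (p ^ e.+1) ^ d.-1))%N.
    by rewrite expnS expnMn !mulnA.
  have iFc := idealadd_ideal (c ^+ p) iF.
  apply: qlen_le => //; apply: (@ilen_pow _ _ m_ideal _ c) => //; first exact: mem_idealadd.
  apply: ilenS (HC e.+1) => //; [exact: idealadd_ideal|exact: idealadd_ideal|].
  apply: idealadd_sub; [exact: idealadd_ideal| |exact: mem_idealadd].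
  move=> x Jx; do 2!apply: sub_idealadd; rewrite frobenius_power_Jz; exact: sub_idealadd.
apply: leq_trans H2 _; rewrite leq_add2l; apply: leq_trans (leq_addl _ _).
rewrite -mulnA leq_mul2l; apply/orP; right; apply: qlen_le; first exact: idealadd_ideal.
apply: ilenS (HC e) => //; [exact: idealadd_ideal|exact: idealadd_ideal|].
apply: idealadd_sub; [exact: idealadd_ideal| |exact: mem_idealadd].
by move=> x Jx; do 2!apply: sub_idealadd.
Qed.

Lemma quotient_length_phi a n e :
  quotient_length (frobenius_power (root_ideal J z a n.+1) (p ^ e)) =
   ((n.+1 - a * p ^ e %% n.+1) * L e (a * p ^ e %/ n.+1) +
    a * p ^ e %% n.+1 * L e (a * p ^ e %/ n.+1).+1)%N.
Proof.
have [k Jk] := finJq e.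
exact: (quotient_length_root_ideal _ _ m_field m_ideal mz R_char Jk).
Qed.

End LengthFunction.

(** * Piecewise linear interpolation of concave sequences *)

Section Interpolation.
Variables (K : realType) (l : nat -> K).
Hypotheses (l0 : l 0%N = 0) (l_mono : forall n, l n <= l n.+1).
Hypothesis l_concave : forall n, l n.+2 + l n <= l n.+1 + l n.+1.

Definition tangent n (s : K) : K := l n + (s - n%:R) * (l n.+1 - l n).

Definition interp (s : K) : K := tangent (Num.trunc s) s.

Let slope n : K := l n.+1 - l n.

Let slope_ge0 n : 0 <= slope n. Proof. by rewrite subr_ge0. Qed.

Let slope_anti i j : (i <= j)%N -> slope j <= slope i.
Proof.
move=> /subnK <-; elim: (j - i)%N => // k IH; rewrite addSn.
apply: le_trans IH; have := l_concave (k + i); rewrite /slope; lra.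
Qed.

Let slope_le n : slope n <= l 1%N.
Proof. by have := slope_anti (leq0n n); rewrite {2}/slope l0 subr0. Qed.

Lemma tangentS n s : tangent n.+1 s - tangent n s = (s - n.+1%:R) * (slope n.+1 - slope n).
Proof. by rewrite /tangent /slope -natr1; ring. Qed.

(** The interpolation is the infimum of its tangents, hence is concave. *)
Lemma interp_le_tangent n s : 0 <= s -> interp s <= tangent n s.
Proof.
move=> s0; rewrite /interp; set k := Num.trunc s.
have /andP[le_ks lt_sk] := truncn_itv s0; rewrite -/k in le_ks lt_sk.
have dslope i : slope i.+1 - slope i <= 0 by rewrite subr_le0 slope_anti.
case: (leqP k n) => [/subnK <-|/ltnW/subnK eqk].
  elim: (n - k)%N => [|j IH]; first by rewrite add0n.
  apply: le_trans IH _; rewrite addSn -subr_ge0 tangentS mulr_le0 // subr_le0.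
  by rewrite (le_trans (ltW lt_sk)) // ler_nat ltnS leq_addl.
rewrite -eqk; have : (k - n + n <= k)%N by rewrite eqk.
elim: (k - n)%N => [|j IH] lejk; first by rewrite add0n.
apply: le_trans (IH (ltnW lejk)); rewrite addSn -subr_le0 tangentS mulr_ge0_le0 // subr_ge0.
by rewrite (le_trans _ le_ks) // ler_nat -addSn.
Qed.

Lemma tangent_affine n a s t :
  tangent n (a * s + (1 - a) * t) = a * tangent n s + (1 - a) * tangent n t.
Proof. by rewrite /tangent; ring. Qed.

Lemma interp_concave a s t : 0 <= a -> a <= 1 -> 0 <= s -> 0 <= t ->
  a * interp s + (1 - a) * interp t <= interp (a * s + (1 - a) * t).
Proof.
move=> a0 a1 s0 t0; rewrite {3}/interp tangent_affine lerD // ler_wpM2l ?subr_ge0 //;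
  exact: interp_le_tangent.
Qed.

Lemma interp_lip s t : 0 <= s -> 0 <= t ->
  `|interp s - interp t| <= l 1%N * `|s - t|.
Proof.
have H x y : 0 <= x -> 0 <= y -> interp x - interp y <= l 1%N * `|x - y|.
  move=> x0 y0; have := interp_le_tangent (Num.trunc y) x0.
  rewrite {2}/interp => le_x.
  apply: (@le_trans _ _ (tangent (Num.trunc y) x - tangent (Num.trunc y) y)); first by rewrite lerD2r.
  have -> : tangent (Num.trunc y) x - tangent (Num.trunc y) y = slope (Num.trunc y) * (x - y).
    by rewrite /tangent /slope; ring.
  apply: (@le_trans _ _ (slope (Num.trunc y) * `|x - y|)); first by rewrite ler_wpM2l // ler_norm.
  by rewrite ler_wpM2r.
by move=> s0 t0; rewrite ler_norml H // andbT lerNl opprB distrC H.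
Qed.

Lemma interp_nat n : interp n%:R = l n.
Proof.
by rewrite /interp (@truncn_def _ _ n) ?lexx ?ltr_nat //= /tangent subrr mul0r addr0.
Qed.

Lemma interp_frac c rho b : (0 < b)%N -> (rho < b)%N ->
  b%:R * interp ((c * b + rho)%:R / b%:R) = (b - rho)%:R * l c + rho%:R * l c.+1.
Proof.
move=> b0 lt_rho; have bn0 : b%:R != 0 :> K by rewrite pnatr_eq0 -lt0n.
have bp : 0 < b%:R :> K by rewrite ltr0n.
rewrite /interp (@truncn_def _ _ c); last first.
  rewrite ler_pdivlMr // ltr_pdivrMr // -!natrM ler_nat ltr_nat leq_addr /=.
  by rewrite mulSn addnC ltn_add2r.
rewrite /tangent natrD natrM natrB 1?ltnW //.
by field.
Qed.

Lemma interp_bound B s : 0 <= s -> (forall n, l n <= B) -> 0 <= interp s <= B.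
Proof.
move=> s0 lB; rewrite /interp; set k := Num.trunc s.
have /andP[le_ks lt_sk] := truncn_itv s0; rewrite -/k in le_ks lt_sk.
have l_ge0 n : 0 <= l n.
  by elim: n => [|n IH]; [rewrite l0|apply: le_trans (l_mono n)].
rewrite /tangent -natr1 in lt_sk *; set th := s - k%:R.
have th0 : 0 <= th by rewrite subr_ge0.
have th1 : th <= 1 by rewrite lerBlDl ltW.
have -> : l k + th * (l k.+1 - l k) = (1 - th) * l k + th * l k.+1 by ring.
rewrite addr_ge0 ?mulr_ge0 ?subr_ge0 //=.
have -> : B = (1 - th) * B + th * B by ring.
by rewrite lerD // ler_wpM2l // subr_ge0.
Qed.

End Interpolation.

(** Adding 2 C / p ^ e to the sequence makes it nonincreasing: the tail of the
    series of errors is at most that. *)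
Lemma almost_nonincreasing_cvg (K : realType) (p : nat) (u : nat -> K) (B C : K) :
  (1 < p)%N -> 0 <= C -> (forall e, - B <= u e) ->
  (forall e, u e.+1 <= u e + C / (p ^ e)%:R) -> cvgn u.
Proof.
move=> p1 C0 uB ustep.
have inv0 : (fun e => C * 2 / (p ^ e)%:R : K) @ \oo --> (0 : K).
  have pinv : `|(p%:R : K)^-1| < 1.
    by rewrite ger0_norm ?invr_ge0 // invf_lt1 ?ltr1n // ltr0n ltnW.
  have := cvg_geometric (C * 2) pinv; apply: cvg_trans; apply: near_eq_cvg.
  by apply: nearW => e; rewrite /geometric /= natrX exprVn.
pose v e := u e + C * 2 / (p ^ e)%:R.
have vcvg : cvgn v.
  apply: nonincreasing_is_cvgn; last first.
    exists (- B) => _ [e _ <-]; rewrite (le_trans (uB e)) // lerDl.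
    by rewrite mulr_ge0 ?mulr_ge0 // invr_ge0.
  apply/nonincreasing_seqP => e; rewrite /v.
  apply: (@le_trans _ _ (u e + C / (p ^ e)%:R + C * 2 / (p ^ e.+1)%:R)); first by rewrite lerD2r.
  rewrite -addrA lerD2l.
  have q0 : 0 < (p ^ e)%:R :> K by rewrite ltr0n expn_gt0 ltnW.
  have pp : 0 < p%:R :> K by rewrite ltr0n ltnW.
  have -> : C * 2 / (p ^ e)%:R = C / (p ^ e)%:R + C / (p ^ e)%:R by rewrite mulr_natr mulr2n mulrDl.
  rewrite lerD2l expnS natrM invfM mulrA ler_pM2r ?invr_gt0 // ler_pdivrMr //.
  by rewrite ler_wpM2l // ler_nat.
have -> : u = v \- (fun e => C * 2 / (p ^ e)%:R) by apply/funext => e; rewrite /v /= addrK.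
by apply: is_cvgB => //; apply/cvg_ex; exists 0.
Qed.

(** * The limit of the normalized length functions *)

Section LimitFunction.
Variables (K : realType) (p d r C0 C1 C2 : nat) (L : nat -> nat -> nat).
Hypotheses (p_gt1 : (1 < p)%N) (d_gt0 : (0 < d)%N).
Hypotheses (L_0 : forall e, L e 0 = 0%N) (L_mono : forall e n, (L e n <= L e n.+1)%N).
Hypothesis L_concave : forall e n, (L e n.+2 + L e n <= L e n.+1 + L e n.+1)%N.
Hypothesis L_bound : forall e n, (L e n <= C0 * (p ^ e) ^ d)%N.
Hypothesis L_bound1 : forall e, (L e 1 <= C1 * (p ^ e) ^ d.-1)%N.
Hypothesis L_frobenius : forall e n,
  (L e.+1 (n * p) <= r * L e n + C2 * (p ^ e) ^ d.-1)%N /\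
  (r * L e n <= L e.+1 (n * p) + C2 * (p ^ e) ^ d.-1)%N.

Definition norm_length e n : K := (L e n)%:R / (p ^ (e * d))%:R.

Let l := norm_length.
Let q e : K := (p ^ e)%:R.
Let f e (t : K) : K := interp (l e) (q e * t).

Let q_gt0 e : 0 < q e. Proof. by rewrite ltr0n expn_gt0 ltnW. Qed.
Let qd_gt0 e : 0 < (p ^ (e * d))%:R :> K. Proof. by rewrite ltr0n expn_gt0 ltnW. Qed.
Let p_gt0 : 0 < p%:R :> K. Proof. by rewrite ltr0n ltnW. Qed.
Let qdE e : (p ^ (e * d))%:R = ((p ^ e) ^ d.-1)%:R * q e :> K.
Proof. by rewrite -natrM -expnSr prednK // -expnM. Qed.

Let l_0 e : l e 0%N = 0. Proof. by rewrite /l /norm_length L_0 mul0r. Qed.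

Let l_mono e n : l e n <= l e n.+1.
Proof. by rewrite ler_pM2r ?invr_gt0 // ler_nat. Qed.

Let l_concave e n : l e n.+2 + l e n <= l e n.+1 + l e n.+1.
Proof. by rewrite -!mulrDl ler_pM2r ?invr_gt0 // -!natrD ler_nat. Qed.

Let l_bound e n : l e n <= C0%:R.
Proof. by rewrite ler_pdivrMr // -natrM ler_nat expnM. Qed.

Let err_bound C e n : (n <= C * (p ^ e) ^ d.-1)%N -> n%:R / (p ^ (e * d))%:R <= C%:R / q e.
Proof.
move=> le_n; rewrite ler_pdivrMr // qdE mulrA mulrAC divfK ?gt_eqF //.
by rewrite -natrM ler_nat.
Qed.

Let l_bound1 e : l e 1%N <= C1%:R / q e. Proof. exact: err_bound. Qed.

Let f_lip e s t : 0 <= s -> 0 <= t -> `|f e s - f e t| <= C1%:R * `|s - t|.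
Proof.
move=> s0 t0; apply: le_trans (interp_lip (l_0 e) (@l_mono e) (@l_concave e) _ _) _;
  try by rewrite mulr_ge0 // ltW.
rewrite -mulrBr normrM (gtr0_norm (q_gt0 e)) mulrA ler_wpM2r //.
by rewrite -ler_pdivlMr.
Qed.

Let f_concave e a s t : 0 <= a -> a <= 1 -> 0 <= s -> 0 <= t ->
  a * f e s + (1 - a) * f e t <= f e (a * s + (1 - a) * t).
Proof.
move=> a0 a1 s0 t0; rewrite /f.
have -> : q e * (a * s + (1 - a) * t) = a * (q e * s) + (1 - a) * (q e * t) by ring.
by apply: interp_concave => //; rewrite mulr_ge0 // ltW.
Qed.

Let f_bound e t : 0 <= t -> 0 <= f e t <= C0%:R.
Proof. by move=> t0; apply: interp_bound => //; rewrite mulr_ge0 // ltW. Qed.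

Let rho : K := r%:R / (p ^ d)%:R.
Let C3 : K := C1%:R + rho * C1%:R + C2%:R.

Let rho_ge0 : 0 <= rho. Proof. by rewrite divr_ge0. Qed.

Let l_frobenius e n :
  l e.+1 (n * p)%N <= rho * l e n + C2%:R / q e /\
  rho * l e n <= l e.+1 (n * p)%N + C2%:R / q e.
Proof.
have [H1 H2] := L_frobenius e n.
have pd_gt0 : 0 < (p ^ d)%:R :> K by rewrite ltr0n expn_gt0 ltnW.
have pd_ge1 : 1 <= (p ^ d)%:R :> K by rewrite ler1n expn_gt0 ltnW.
have qS : (p ^ (e.+1 * d))%:R = (p ^ (e * d))%:R * (p ^ d)%:R :> K.
  by rewrite mulSn addnC expnD natrM.
have errS : (C2 * (p ^ e) ^ d.-1)%:R / (p ^ (e.+1 * d))%:R <= C2%:R / q e :> K.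
  apply: le_trans (err_bound (leqnn _)); rewrite ler_wpM2l // lef_pV2 ?posrE //.
  by rewrite qS ler_peMr // ltW.
have rhol : rho * l e n = (r * L e n)%:R / (p ^ (e.+1 * d))%:R.
  by rewrite qS natrM invfM [X in _ = _ * X]mulrC mulrACA.
rewrite rhol; split; apply: le_trans (lerD (lexx _) errS).
all: by rewrite -mulrDl ler_wpM2r ?invr_ge0 // -natrD ler_nat.
Qed.

(* At the point n / p ^ e next to t, this is the comparison of L e n with
   L e.+1 (n p); moving to t costs the Lipschitz bound of f. *)
Let f_frobenius e t : 0 <= t ->
  f e.+1 t <= rho * f e t + C3 / q e /\ rho * f e t <= f e.+1 t + C3 / q e.
Proof.
move=> t0; pose n := Num.trunc (q e * t); pose x : K := n%:R / q e.
have qt0 : 0 <= q e * t by rewrite mulr_ge0 // ltW.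
have x0 : 0 <= x by rewrite divr_ge0 // ltW.
have dist : `|t - x| <= (q e)^-1.
  have /andP[le_n lt_n] := truncn_itv qt0; rewrite -/n in le_n lt_n.
  have -> : t - x = (q e * t - n%:R) / q e by rewrite mulrBl mulrC mulKf // gt_eqF.
  have qV0 : 0 <= (q e)^-1 by rewrite invr_ge0 ltW.
  rewrite normrM [X in _ * X]ger0_norm // -[leRHS]mul1r ler_wpM2r //.
  by rewrite ger0_norm ?subr_ge0 // lerBlDl natr1 ltW.
have fx e' : `|f e' t - f e' x| <= C1%:R / q e.
  by apply: le_trans (f_lip e' t0 x0) _; rewrite ler_wpM2l.
have fex : f e x = l e n by rewrite /f /x mulrC divfK ?gt_eqF // interp_nat.
have feSx : f e.+1 x = l e.+1 (n * p)%N.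
  rewrite /f /x; have -> : q e.+1 * (n%:R / q e) = (n * p)%:R.
    have qn0 : (p ^ e)%:R != 0 :> K by rewrite gt_eqF // (q_gt0 e).
    by rewrite /q expnSr !natrM; field.
  exact: interp_nat.
have [H1 H2] := l_frobenius e n; rewrite -fex -feSx in H1 H2.
have := fx e; have := fx e.+1; rewrite !ler_norml => /andP[a1 a2] /andP[b1 b2].
have rb1 := ler_wpM2l rho_ge0 b1; have rb2 := ler_wpM2l rho_ge0 b2.
have C3E : C3 / q e = C1%:R / q e + rho * (C1%:R / q e) + C2%:R / q e.
  by rewrite /C3 !mulrDl mulrA.
rewrite C3E; move: rb1 rb2; rewrite !mulrBr mulrN => rb1 rb2.
split; lra.
Qed.

(** The ratio rho of successive terms, up to an error of order 1 / p ^ e, makes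
    the bounded sequence monotone up to a summable error, whether it is at most
    or at least one. *)
Lemma f_cvg t : 0 <= t -> cvgn (f ^~ t).
Proof.
move=> t0; have C3_ge0 : 0 <= C3 by rewrite /C3 !addr_ge0 // mulr_ge0.
case: (leP rho 1) => [le_rho|/ltW ge_rho].
  apply: (@almost_nonincreasing_cvg _ p _ 0 C3) => // e; have /andP[fe0 _] := f_bound e t0.
    by rewrite oppr0.
  have [H _] := f_frobenius e t0; apply: le_trans H _; rewrite lerD2r.
  exact: ler_piMl.
have Nf_cvg : cvgn (fun e => - f e t).
  apply: (@almost_nonincreasing_cvg _ p _ C0%:R C3) => // e; have /andP[fe0 fe1] := f_bound e t0.
    by rewrite lerN2.
  have [_ H] := f_frobenius e t0; rewrite -lerBlDr.
  apply: (@le_trans _ _ (- (rho * f e t))); first by move: H; rewrite /q; lra.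
  by rewrite lerN2 ler_peMl.
have -> : f ^~ t = - (fun e => - f e t).
  by apply/funext => e; rewrite -[RHS]/(- - f e t) opprK.
exact: is_cvgN.
Qed.

Definition limit_length t : K := limn (f ^~ t).

Lemma limit_concave a s t : 0 <= a -> a <= 1 -> 0 <= s -> 0 <= t ->
  a * limit_length s + (1 - a) * limit_length t <= limit_length (a * s + (1 - a) * t).
Proof.
move=> a0 a1 s0 t0; have st0 : 0 <= a * s + (1 - a) * t.
  by rewrite addr_ge0 // mulr_ge0 // subr_ge0.
apply: (@ler_cvg_to _ \oo _ _ (fun e => a * f e s + (1 - a) * f e t)
  (f ^~ (a * s + (1 - a) * t))).
- by apply: cvgD; apply: cvgMl_tmp; apply: f_cvg.
- exact: f_cvg.
- by apply: nearW => e; apply: f_concave.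
Qed.

Lemma limit_lip s t : 0 <= s -> 0 <= t ->
  `|limit_length s - limit_length t| <= C1%:R * `|s - t|.
Proof.
move=> s0 t0; apply: (@ler_cvg_to _ \oo _ _ (fun e => `|f e s - f e t|)
  (fun=> C1%:R * `|s - t|)).
- by apply: cvg_norm; apply: cvgB; apply: f_cvg.
- exact: cvg_cst.
- by apply: nearW => e; apply: f_lip.
Qed.

Lemma limit_frac a b : (0 < b)%N ->
  b%:R^-1 * limn (fun e => ((b - a * p ^ e %% b) * L e (a * p ^ e %/ b) +
      a * p ^ e %% b * L e (a * p ^ e %/ b).+1)%:R / (p ^ (e * d))%:R : K) =
  limit_length (a%:R / b%:R).
Proof.
move=> b_gt0; have b0 : b%:R != 0 :> K by rewrite pnatr_eq0 -lt0n.
have t0 : 0 <= a%:R / b%:R :> K by rewrite divr_ge0.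
rewrite [X in limn X](_ : _ = (fun e => b%:R * f e (a%:R / b%:R))).
  have -> : limn (fun e => b%:R * f e (a%:R / b%:R)) = b%:R * limit_length (a%:R / b%:R).
    by apply: cvg_lim => //; apply: cvgMl_tmp; apply: f_cvg.
  by rewrite mulKf.
apply/funext => e; rewrite /f.
have -> : q e * (a%:R / b%:R) = (a * p ^ e %/ b * b + a * p ^ e %% b)%:R / b%:R.
  by rewrite -divn_eq natrM mulrA [q e * _]mulrC.
rewrite interp_frac ?ltn_mod // /l /norm_length natrD !natrM mulrDl.
by rewrite !mulrA.
Qed.

Lemma limit_seq (s : nat -> rat) (t : K) : 0 <= t -> (forall k, 0 < s k) ->
  (ratr (s k) : K) @[k --> \oo] --> t ->
  limit_length (ratr (s k)) @[k --> \oo] --> limit_length t.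
Proof.
move=> t0 s_gt0 s_t; apply/cvgrPdist_le => eps eps0.
have C1_gt0 : 0 < C1%:R + 1 :> K by rewrite ltr_wpDl.
have del : 0 < eps / (C1%:R + 1) by rewrite divr_gt0.
move/cvgrPdist_le: s_t => /(_ _ del); apply: filterS => k le_k.
apply: le_trans (limit_lip t0 _) _; first by rewrite ler0q ltW.
apply: (@le_trans _ _ ((C1%:R + 1) * `|t - ratr (s k)|)).
  by rewrite ler_wpM2r // lerDl.
by rewrite mulrC -ler_pdivlMr.
Qed.
End LimitFunction.

(** There is a sequence to which the defining property of [phi] applies, so that
    it determines the value of [phi]. *)
Lemma rat_approx (K : realType) (t : K) : 0 <= t ->
  exists s : nat -> rat, (forall k, 0 < s k) /\ ((ratr (s k) : K) @[k --> \oo] --> t).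
Proof.
move=> t0.
have exs k : {s : rat | ratr s \in `]t, (t + harmonic k)[}.
  by apply: cid; apply: rat_in_itvoo; rewrite ltrDl /harmonic /= invr_gt0.
pose s k := sval (exs k).
have s_itv k : t < ratr (s k) < t + harmonic k by have := svalP (exs k); rewrite in_itv.
exists s; split=> [k|].
  by have /andP[lt_ts _] := s_itv k; rewrite -(ltr0q K); apply: le_lt_trans lt_ts.
apply: (@squeeze_cvgr _ _ _ _ (fun=> t) (fun k => t + harmonic k)).
- by apply: nearW => k; have /andP[/ltW -> /ltW ->] := s_itv k.
- exact: cvg_cst.
- by rewrite -[X in _ --> X]addr0; apply: cvgD; [exact: cvg_cst|exact: cvg_harmonic].
Qed.

Theorem lemma3p8 (K : realType) (R : idomainType) (m : set R)
  (kappa : closedFieldType) (pi : {rmorphism R -> kappa}) (p : nat)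
  (R_noetherian : noetherian R) (R_local : is_local m)
  (R_residue : residue_map m pi)
  (R_complete : complete_for m) (R_normal : normal_domain R)
  (R_char : p \in [pchar R])
  (z : R) (z_in : (m `\` ideal_pow m 2) z)
  (J : set R) (J_primary : primary_to m J)
  (t1 t2 alpha : K) (t1_ge0 : 0 <= t1) (t2_ge0 : 0 <= t2)
  (alpha_ge0 : 0 <= alpha) (alpha_le1 : alpha <= 1) :
  phi p J z (alpha * t1 + (1 - alpha) * t2) >=
    alpha * phi p J z t1 + (1 - alpha) * phi p J z t2.
Proof.
have [mz nmz] := z_in; have [[iJ _ _] radJ] := J_primary.
have z0 : z != 0.
  by apply/eqP => z0; apply: nmz; rewrite z0; apply: ideal0 (ideal_pow_ideal _ _).
have J_nil x : m x -> exists n, J (x ^+ n) by rewrite -radJ.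
have p_gt1 : (1 < p)%N by move: R_char; rewrite inE => /andP[/prime_gt1].
pose L := root_length p J z; pose d := krull_dim R.
have [C0 L_bound] := root_length_bound p R_noetherian R_local z iJ J_nil.
have [C1 L_bound1] := root_length1_bound p R_noetherian R_local z0 mz iJ J_nil.
have [r [C2 L_frob]] := root_length_frobenius R_noetherian R_local R_residue
  R_complete R_char z0 mz iJ J_nil.
have d_gt0 : (0 < d)%N := krull_dim_gt0 R_noetherian R_local z0 mz.
have L_0 := root_length0 p R_noetherian R_local z J.
have L_mono := root_length_mono p R_noetherian R_local z iJ J_nil.
have L_concave := root_length_concave p R_noetherian R_local z iJ J_nil.
pose F (t : K) := limit_length p d L t.
have phi_ratE (s : rat) : 0 < s -> phi_rat K p J z s = F (ratr s).
  move=> s_gt0; have num_gt0 : 0 < numq s by rewrite numq_gt0.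
  have den_gt0 := denq_gt0 s.
  rewrite /phi_rat gt_eqF // /phi_frac /eHK.
  have -> : ratr s = `|numq s|%N%:R / `|denq s|%N%:R :> K.
    by rewrite /ratr !natr_absz !gtr0_norm.
  have : (0 < `|denq s|)%N by rewrite absz_gt0 gt_eqF.
  case: `|denq s|%N => // b _; rewrite krull_dim_root.
  rewrite /F -(limit_frac K p_gt1 d_gt0 L_0 L_mono L_concave L_bound L_bound1 L_frob) //.
  apply: (congr1 (fun u : nat -> K => b.+1%:R^-1 * limn u)); apply/funext => e.
  by rewrite (quotient_length_phi R_noetherian R_local R_char mz iJ J_nil).
have phiE (t : K) : 0 <= t -> phi p J z t = F t.
  move=> t_ge0; have Fseq (s : nat -> rat) : (forall k, 0 < s k) ->
      (ratr (s k) : K) @[k --> \oo] --> t -> phi_rat K p J z (s k) @[k --> \oo] --> F t.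
    move=> s_gt0 s_t.
    have -> : (fun k => phi_rat K p J z (s k)) = (fun k => F (ratr (s k))).
      by apply/funext => k; apply: phi_ratE.
    exact: limit_seq p_gt1 d_gt0 L_0 L_mono L_concave L_bound L_bound1 L_frob _ _ _ _ _.
  apply: xget_unique => [|v Hv]; first exact: Fseq.
  have [s [s_gt0 s_t]] := rat_approx t_ge0.
  exact: cvg_unique (Hv s s_gt0 s_t) (Fseq s s_gt0 s_t).
rewrite !phiE ?addr_ge0 ?mulr_ge0 ?subr_ge0 //.
exact: (limit_concave p_gt1 d_gt0 L_0 L_mono L_concave L_bound L_bound1 L_frob).
Qed.
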